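(* Let $X$ and $Y$ be Banach spaces (both real or both complex), and let $U$ and $V$ be closed subspaces of $X$ and $Y$, respectively. Let $S\in \mathcal{F}(X^{**}, Y^{**})$ satisfy $S(U^{\perp\perp})\subset V^{\perp\perp}$. Let $E$ and $F$ be finite-dimensional subspaces of $X^{**}$ and $Y^*$, respectively, and let $\varepsilon>0$. Then there exists an operator $T\in \mathcal{F}(X,Y)$ satisfying $T(U)\subset V$ such that (1) $\bigl| \| T\|-\| S\|\bigr|<\varepsilon$; (2) $x^{**}(T^*y^* )=(Sx^{**})(y^* )$ for all $x^{**}\in E$ and all $y^*\in F$; (3) $T^{**}x^{**}=Sx^{**}$ for all those $x^{**}\in E$ for which $Sx^{**}\in Y$. Moreover, if the restriction $S|_E$ is one-to-one, then $T^{**}|_E$ is also one-to-one, and $\|(T^{**}|_E)^{-1}\| < \|(S|_E)^{-1}\| + \varepsilon$ (the inverses being taken as operators from $S(E)$, respectively $T^{**}(E)$, onto $E$). In the special case when $X=Y$ and $S$ is a projection, $T$ can also be taken to be a projection.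
   Context: For Banach spaces $X,Y$, $\mathcal{F}(X,Y)$ denotes the space of bounded linear finite-rank operators from $X$ to $Y$. For a subspace $U$ of $X$, $U^\perp=\{x^*\in X^*: x^*(x)=0\ \forall x\in U\}$ is its annihilator in $X^*$, and $U^{\perp\perp}=(U^\perp)^\perp\subset X^{**}$. Banach spaces are regarded as subspaces of their biduals via the canonical embedding. *)

(* Defs.v *)
From mathcomp Require Import all_boot all_order all_algebra.
From mathcomp Require Import all_classical all_reals all_analysis.
From mathcomp Require Import complex.
Import Order.TTheory GRing.Theory Num.Theory.
Set Implicit Arguments. Unset Strict Implicit. Unset Printing Implicit Defensive.
Local Open Scope ring_scope.
Local Open Scope classical_set_scope.

(* The scalar field: [bscalar R false] = the reals R, [bscalar R true] = the
   complex numbers R[i].  Quantifying over the boolean covers exactly the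
   two cases "both real" / "both complex". *)
Definition bscalar (R : realType) (b : bool) : numFieldType :=
  if b then (R[i] : numFieldType) else (R : numFieldType).

Section BanachDefs.
Context {K : numFieldType}.

Definition is_lubK (A : set K) (c : K) : Prop :=
  (forall s, A s -> s <= c) /\ (forall d, (forall s, A s -> s <= d) -> c <= d).
Definition supK (A : set K) : K := xget 0 (is_lubK A).

Section Spaces.
Variable X : normedModType K.

Definition subspace (U : set X) : Prop :=
  U 0 /\ forall (a : K) x y, U x -> U y -> U (a *: x + y).
Definition closed_subspace (U : set X) : Prop := subspace U /\ closed U.

Definition is_lin (Y : normedModType K) (T : X -> Y) : Prop :=
  forall (a : K) x y, T (a *: x + y) = a *: T x + T y.
Definition is_bdd (Y : normedModType K) (T : X -> Y) : Prop :=
  exists M : K, forall x, `|T x| <= M * `|x|.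
Definition finite_rank (Y : normedModType K) (T : X -> Y) : Prop :=
  exists (n : nat) (v : 'I_n -> Y), forall x, exists c : 'I_n -> K,
    T x = \sum_(i < n) c i *: v i.
Definition opnorm (Y : normedModType K) (T : X -> Y) : K :=
  supK [set `|T x| | x in [set x : X | `|x| <= 1]].

Definition dual1 : set (X -> K) :=
  [set f | (forall (a : K) x y, f (a *: x + y) = a * f x + f y) /\
           exists M : K, forall x, `|f x| <= M * `|x|].
Definition n1 (f : X -> K) : K :=
  supK [set `|f x| | x in [set x : X | `|x| <= 1]].

(* ---- the bidual X^{**} : bounded linear functionals on X^{*}.  An element
   is represented by a function (X -> K) -> K, normalised to vanish
   outside X^{*} , so that the representation is unique (Leibniz equality
   = equality of functionals on X^{*} ). ---- *)
Definition bidual : set ((X -> K) -> K) :=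
  [set phi | (forall (a : K) f g, dual1 f -> dual1 g ->
                 phi (fun x => a * f x + g x) = a * phi f + phi g) /\
             (exists M : K, forall f, dual1 f -> `|phi f| <= M * n1 f) /\
             (forall f, ~ dual1 f -> phi f = 0)].
Definition n2 (phi : (X -> K) -> K) : K :=
  supK [set `|phi f| | f in [set f | dual1 f /\ n1 f <= 1]].

Definition canJ (x : X) : (X -> K) -> K :=
  fun f => if `[< dual1 f >] then f x else 0.

Definition annih (U : set X) : set (X -> K) :=
  [set f | dual1 f /\ forall u, U u -> f u = 0].
Definition annih2 (U : set X) : set ((X -> K) -> K) :=
  [set phi | bidual phi /\ forall f, annih U f -> phi f = 0].

Definition span1 (m : nat) (g : 'I_m -> X -> K) : set (X -> K) :=
  [set f | exists c : 'I_m -> K, f = fun x => \sum_(j < m) c j * g j x].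
Definition span2 (n : nat) (e : 'I_n -> (X -> K) -> K) : set ((X -> K) -> K) :=
  [set phi | exists c : 'I_n -> K, phi = fun f => \sum_(i < n) c i * e i f].
End Spaces.

Section Operators.
Variables X Y : normedModType K.

Definition adj1 (T : X -> Y) (g : Y -> K) : X -> K := fun x => g (T x).
Definition adj2 (T : X -> Y) (phi : (X -> K) -> K) : (Y -> K) -> K :=
  fun g => if `[< dual1 g >] then phi (adj1 T g) else 0.

Definition bidual_op (S : ((X -> K) -> K) -> ((Y -> K) -> K)) : Prop :=
  (forall phi, bidual phi -> bidual (S phi)) /\
  (forall (a : K) phi psi, bidual phi -> bidual psi ->
     S (fun f => a * phi f + psi f) = (fun g => a * S phi g + S psi g)) /\
  (exists M : K, forall phi, bidual phi -> n2 (S phi) <= M * n2 phi) /\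
  (exists (n : nat) (w : 'I_n -> (Y -> K) -> K), forall phi, bidual phi ->
     exists c : 'I_n -> K, S phi = fun g => \sum_(i < n) c i * w i g).

Definition opnorm2 (S : ((X -> K) -> K) -> ((Y -> K) -> K)) : K :=
  supK [set n2 (S phi) | phi in [set phi | bidual phi /\ n2 phi <= 1]].

(* norm of the inverse of S|_E : S(E) -> E, i.e.
   sup { ||phi|| : phi in E, ||S phi|| <= 1 } *)
Definition inv_norm_on (E : set ((X -> K) -> K))
    (S : ((X -> K) -> K) -> ((Y -> K) -> K)) : K :=
  supK [set n2 phi | phi in [set phi | E phi /\ n2 (S phi) <= 1]].

Definition thm12_hyps (U : set X) (V : set Y)
    (S : ((X -> K) -> K) -> ((Y -> K) -> K))
    (n : nat) (e : 'I_n -> (X -> K) -> K) (m : nat) (g : 'I_m -> Y -> K)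
    (eps : K) : Prop :=
  [/\ closed_subspace U /\ closed_subspace V, bidual_op S,
      (forall phi, annih2 U phi -> annih2 V (S phi)),
      (forall i, bidual (e i)) /\ (forall j, dual1 (g j)) & 0 < eps].

Definition thm12_concl (U : set X) (V : set Y)
    (S : ((X -> K) -> K) -> ((Y -> K) -> K))
    (n : nat) (e : 'I_n -> (X -> K) -> K) (m : nat) (g : 'I_m -> Y -> K)
    (eps : K) (T : X -> Y) : Prop :=
  let E := span2 e in let F := span1 g in
  [/\ (is_lin T /\ is_bdd T /\ finite_rank T) /\
        (forall u, U u -> V (T u)),
      `|opnorm T - opnorm2 S| < eps,
      (forall phi ys, E phi -> F ys -> phi (adj1 T ys) = S phi ys),
      (forall phi, E phi -> (exists y : Y, S phi = canJ y) ->
          adj2 T phi = S phi) &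
      ({in E &, injective S} ->
         {in E &, injective (adj2 T)} /\
         inv_norm_on E (adj2 T) < inv_norm_on E S + eps)].
End Operators.
End BanachDefs.

(* Main.v *)
(* Write [S = \sum_j xi_j (x) z_j] with [z] a basis of the (finite-dimensional) range
   of [S] and [xi_j] in [X***], and look for [T = \sum_j f_j (x) y_j] with [f_j] in [X*]
   and [y_j] in [Y].  Both families come from one simultaneous Helly theorem, itself a
   consequence of Hahn-Banach in a finite power of the space: finitely many elements
   of a bidual can be replaced by elements of the space, keeping the values on
   finitely many functionals, the membership in given subspaces and, up to [epsilon], the
   norms of finitely many combinations.  It is applied to [X*] first, the combinations
   being the values of [z] on functionals of [Y*] that almost norm the range of [S], and
   then to [Y], the combinations being a net of the unit ball of the range.  Choosing
   [y] after [f] allows [f_i (y_j) = z_j (f_i) = delta_ij] when [S] is a projection,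
   which makes [T] a projection as well.  Taking [z] adapted to [V^perpperp] and to the
   canonical copy of [Y] yields [T (U) \subset V] and the exact equality (3). *)
Require Import Defs.
From mathcomp Require Import all_boot all_order all_algebra.
From mathcomp Require Import all_classical all_reals all_analysis.
From mathcomp Require Import complex.
From mathcomp Require Import ring lra.
Import Order.TTheory GRing.Theory Num.Theory.
Set Implicit Arguments. Unset Strict Implicit. Unset Printing Implicit Defensive.
Local Open Scope ring_scope.
Local Open Scope classical_set_scope.

(** * Real and complex scalars *)

(** The obstacle is to control norms in both directions by finitely many conditions. Upper bound:
    [T x] is the combination of the [y_j] with coefficients [f_j (x)]. The net of the range compares
    it with the same combination of the [z_j], an almost norming [h_k] reduces that one to a scalar,
    and the scalar is [(\sum_j z_j (h_k) f_j) (x)]. The functional in parentheses replaces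
    [\sum_j z_j (h_k) xi_j], which is [S] followed by evaluation at [h_k], of norm at most [||S||];
    hence the combinations in the first use of Helly's theorem. Lower bounds: a point almost
    attaining the norm of [S] joins [E] and the [h_k] join [F], so that (2) makes [T^**] almost as
    large as [S] at that point and on all of [E]. The inclusion [T (U) \subset V] holds term by
    term. A coordinate of [S] along a [z_j] outside [V^perpperp] vanishes on [U^perpperp], so [f_j]
    can be taken in [U^perp]; for the other indices [y_j] is taken in [V]. *)

Definition emb (R : realType) (b : bool) : R -> bscalar R b :=
  match b return R -> bscalar R b with
  | true => fun r => (r%:C)%C
  | false => fun r => r
  end.

(** Norms take values in the scalar field; [rep] moves them to the reals, where suprema and infima
    exist. It inverts [emb] on nonnegative scalars, which are real by the definition of the complex
    order, and it is also the real part needed for the complex Hahn-Banach theorem. *)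
Definition rep (R : realType) (b : bool) : bscalar R b -> R :=
  match b return bscalar R b -> R with
  | true => fun x => complex.Re x
  | false => fun x => x
  end.

Section Scalars.
Context {R : realType} {b : bool}.
Local Notation K := (bscalar R b).
Local Notation emb := (@emb R b).
Local Notation rep := (@rep R b).


Definition nrm (x : K) : R := rep `|x|.

Lemma repK r : rep (emb r) = r.
Proof. by rewrite /emb /rep; case: (b). Qed.

Lemma embD r s : emb (r + s) = emb r + emb s.
Proof. by rewrite /emb; case: (b) => //; exact: rmorphD. Qed.

Lemma embM r s : emb (r * s) = emb r * emb s.
Proof. by rewrite /emb; case: (b) => //; exact: rmorphM. Qed.

Lemma emb0 : emb 0 = 0.
Proof. by rewrite /emb; case: (b). Qed.

Lemma emb1 : emb 1 = 1.
Proof. by rewrite /emb; case: (b). Qed.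

Lemma embN r : emb (- r) = - emb r.
Proof. by apply/eqP; rewrite -addr_eq0 -embD addNr emb0. Qed.

Lemma embB r s : emb (r - s) = emb r - emb s.
Proof. by rewrite embD embN. Qed.

Lemma ler_emb r s : (emb r <= emb s) = (r <= s).
Proof. by rewrite /emb; case: (b) => //; exact: lecR. Qed.

Lemma ltr_emb r s : (emb r < emb s) = (r < s).
Proof. by rewrite /emb; case: (b) => //; exact: ltcR. Qed.

Lemma repD x y : rep (x + y) = rep x + rep y.
Proof. by move: x y; rewrite /rep; case: (b) => // -[? ?] [? ?]. Qed.

Lemma repM r s : 0 <= r -> 0 <= s -> rep (r * s) = rep r * rep s.
Proof.
move: r s; rewrite /rep; case: (b) => // -[r r'] [s s'].
by rewrite !lecE /= => /andP[/eqP-> _] /andP[/eqP-> _]; rewrite mul0r subr0.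
Qed.

Lemma rep_le x y : x <= y -> rep x <= rep y.
Proof. by move: x y; rewrite /rep; case: (b) => // x y; rewrite lecE => /andP[]. Qed.

Lemma embK x : 0 <= x -> emb (rep x) = x.
Proof.
move: x; rewrite /rep /emb; case: (b) => //= x x0.
by apply: RRe_real; apply: ger0_real.
Qed.

Lemma rep_ge0 x : 0 <= x -> 0 <= rep x.
Proof. by move/rep_le; rewrite -emb0 repK. Qed.

Lemma le_emb_rep x y : 0 <= x -> rep x <= y -> x <= emb y.
Proof. by move=> x0; rewrite -ler_emb embK. Qed.

Lemma emb_nrm x : emb (nrm x) = `|x|. Proof. by rewrite embK. Qed.

Lemma nrm_ge0 x : 0 <= nrm x. Proof. exact: rep_ge0. Qed.

Lemma nrmM x y : nrm (x * y) = nrm x * nrm y.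
Proof. by rewrite /nrm normrM repM. Qed.

Lemma nrmD x y : nrm (x + y) <= nrm x + nrm y.
Proof. by rewrite -repD; apply: rep_le; exact: ler_normD. Qed.

Lemma nrmN x : nrm (- x) = nrm x. Proof. by rewrite /nrm normrN. Qed.

Lemma nrm0 : nrm 0 = 0. Proof. by rewrite /nrm normr0 -emb0 repK. Qed.

Lemma nrm1 : nrm 1 = 1. Proof. by rewrite /nrm normr1 -emb1 repK. Qed.

Lemma nrm_eq0 x : nrm x = 0 -> x = 0.
Proof. by move=> x0; apply/eqP; rewrite -normr_eq0 -emb_nrm x0 emb0. Qed.

Lemma nrm_emb r : 0 <= r -> nrm (emb r) = r.
Proof. by move=> r0; rewrite /nrm ger0_norm ?repK // -emb0 ler_emb. Qed.

Lemma nrm_sum (I : Type) (s : seq I) (P : pred I) (F : I -> K) :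
  nrm (\sum_(i <- s | P i) F i) <= \sum_(i <- s | P i) nrm (F i).
Proof.
elim/big_rec2: _ => [|i r x _ le_xr]; first by rewrite nrm0.
by apply: le_trans (nrmD _ _) _; rewrite lerD2l.
Qed.

Lemma rep_le_nrm x : rep x <= nrm x.
Proof.
rewrite /nrm; move: x; rewrite /rep; case: (b) => [[x y]|x] /=; last exact: ler_norm.
apply: le_trans (ler_norm _) _; rewrite -sqrtr_sqr ler_wsqrtr // lerDl.
exact: sqr_ge0.
Qed.

(** Serves to pass from bounds on real parts to bounds on moduli, and to align phases so that moduli
    add up. *)
Lemma rotate x : exists2 u : K, nrm u = 1 & u * x = emb (nrm x).
Proof.
have [->|x0] := eqVneq x 0.
  by exists 1; rewrite ?nrm1 // mulr0 nrm0 emb0.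
exists (`|x| / x); last by rewrite emb_nrm mulfVK.
by rewrite /nrm normrM normfV normr_id divff ?normr_eq0 // -emb1 repK.
Qed.

(** [supK] is a least upper bound only when one exists. Here the embedded real supremum is one: any
    upper bound of a nonempty set of nonnegative scalars is itself nonnegative, hence real and
    comparable with it. *)
Lemma supK_lub (A : set K) (M : R) : A !=set0 ->
  (forall s, A s -> 0 <= s) -> (forall s, A s -> rep s <= M) ->
  is_lubK A (supK A).
Proof.
move=> [a Aa] A0 AM; apply: (@xgetPex _ 0 (is_lubK A)).
have hs : has_sup [set rep x | x in A].
  split; first by exists (rep a), a.
  by exists M => _ [s As <-]; exact: AM.
exists (emb (sup [set rep x | x in A])); split=> [s As|d dA].
  by apply: le_emb_rep; [exact: A0|apply: (ub_le_sup hs.2); exists s].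
have d0 : 0 <= d by apply: le_trans (A0 _ Aa) (dA _ Aa).
rewrite -[d]embK // ler_emb; apply: ge_sup; first by case: hs.
by move=> _ [s As <-]; apply/rep_le/dA.
Qed.

Lemma real_grid (B eta : R) : 0 < eta ->
  exists (N : nat) (t : 'I_N -> R), forall x : R, `|x| <= B ->
    exists k, `|x - t k| <= eta.
Proof.
move=> eta0; have [N Nlt] : exists N : nat, (B + B) / eta < N%:R.
  exists (Num.truncn ((B + B) / eta)).+1.
  exact: truncnS_gt.
exists N, (fun k : 'I_N => - B + k%:R * eta) => x; rewrite ler_norml => /andP[Bx xB].
set y := (x + B) / eta.
have y0 : 0 <= y by apply: divr_ge0; [rewrite addrC -lerBlDl sub0r|exact: ltW].
have yN : (Num.truncn y < N)%N.
  rewrite -(ltr_nat R); apply: le_lt_trans Nlt.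
  apply: le_trans (_ : y <= _); first by rewrite truncn_le.
  by rewrite /y ler_pM2r ?invr_gt0 // lerD2r.
exists (Ordinal yN) => /=.
have /andP[h1 h2] := truncn_itv y0.
have yE : x + B = y * eta by rewrite /y mulfVK // gt_eqF.
have := ler_wpM2r (ltW eta0) h1; have := ltr_pM2r eta0 y ((Num.truncn y).+1%:R).
rewrite h2 -yE -natr1 mulrDl mul1r => h3 h4.
by rewrite ler_norml; apply/andP; split; lra.
Qed.
End Scalars.

Lemma scalar_grid (R : realType) (b : bool) (B eta : R) : 0 < eta ->
  exists (N : nat) (t : 'I_N -> bscalar R b), forall x, nrm x <= B ->
    exists k, nrm (x - t k) <= eta.
Proof.
case: b => eta0; last exact: real_grid.
have eta20 : 0 < eta / 2 by lra.
have [N [t tP]] := real_grid B eta20.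
exists #|{: 'I_N * 'I_N}|, (fun k => let p := enum_val k in (t p.1 +i* t p.2)%C).
have ReIm (z : R[i]) : `|complex.Re z| <= @nrm R true z /\ `|complex.Im z| <= @nrm R true z.
  rewrite /nrm /=; case: z => x y /=; rewrite -(sqrtr_sqr x) -(sqrtr_sqr y).
  by split; rewrite ler_wsqrtr // (lerDl, lerDr) sqr_ge0.
have nrm_le (z : R[i]) : @nrm R true z <= `|complex.Re z| + `|complex.Im z|.
  rewrite /nrm /=; case: z => x y /=.
  rewrite -[leRHS]ger0_norm ?addr_ge0 // -sqrtr_sqr ler_wsqrtr //.
  have := mulr_ge0 (normr_ge0 x) (normr_ge0 y).
  by rewrite sqrrD !real_normK ?num_real // mulr2n; lra.
move=> x xB; have [hx hy] := ReIm x.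
have [k1 h1] := tP _ (le_trans hx xB); have [k2 h2] := tP _ (le_trans hy xB).
exists (enum_rank (k1, k2)); rewrite enum_rankK /=.
apply: le_trans (nrm_le _) _; case: x {xB hx hy} h1 h2 => x y /= h1 h2.
by lra.
Qed.

(** * Linear functionals on subspaces *)

Section LinearAlgebra.
Context {K : fieldType} {L : lmodType K}.
Implicit Types (D V W : set L) (h : L -> K).

Definition lsub D := D 0 /\ forall (a : K) x y, D x -> D y -> D (a *: x + y).
Definition lin_on D h :=
  forall (a : K) x y, D x -> D y -> h (a *: x + y) = a * h x + h y.

Lemma lsubT : lsub setT. Proof. by []. Qed.

Lemma lsubD D x y : lsub D -> D x -> D y -> D (x + y).
Proof. by move=> [_ DP] Dx Dy; rewrite -[x]scale1r; exact: DP. Qed.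

Lemma lsubZ D a x : lsub D -> D x -> D (a *: x).
Proof. by move=> [D0 DP] Dx; rewrite -[_ *: _]addr0; exact: DP. Qed.

Lemma lsubN D x : lsub D -> D x -> D (- x).
Proof. by move=> DP Dx; rewrite -scaleN1r; exact: lsubZ. Qed.

Lemma lsubB D x y : lsub D -> D x -> D y -> D (x - y).
Proof. by move=> DP Dx Dy; apply: lsubD => //; exact: lsubN. Qed.

Lemma lsub_sum D (I : Type) (s : seq I) (P : pred I) (F : I -> L) : lsub D ->
  (forall i, P i -> D (F i)) -> D (\sum_(i <- s | P i) F i).
Proof.
move=> DP DF; elim/big_ind: _ => //; first by case: DP.
by move=> x y; exact: lsubD.
Qed.

Lemma lsub_ker D h : lsub D -> lin_on D h -> lsub (D `&` [set x | h x = 0]).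
Proof.
move=> DP hP; have D0 := DP.1; have h0 : h 0 = 0.
  have := hP (-1) 0 0 D0 D0.
  by rewrite scaler0 addr0 mulN1r addNr.
split=> [//|a x y [Dx /= hx] [Dy /= hy]]; split; first exact: DP.2.
by rewrite /= hP // hx hy mulr0 addr0.
Qed.

Lemma lin_on0 D h : lsub D -> lin_on D h -> h 0 = 0.
Proof. by move=> DP hP; have [[]] := lsub_ker DP hP. Qed.

Lemma lin_onZ D h a x : lsub D -> lin_on D h -> D x -> h (a *: x) = a * h x.
Proof.
move=> DP hP Dx; have D0 := DP.1.
by rewrite -[_ *: _]addr0 hP // (lin_on0 DP hP) addr0.
Qed.

Lemma lin_onD D h x y : lin_on D h -> D x -> D y -> h (x + y) = h x + h y.
Proof. by move=> hP Dx Dy; rewrite -[x in LHS]scale1r hP // mul1r. Qed.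

Lemma lin_onB D h x y : lsub D -> lin_on D h -> D x -> D y -> h (x - y) = h x - h y.
Proof.
move=> DP hP Dx Dy; rewrite -scaleN1r (lin_onD hP) //; last exact: lsubZ.
by rewrite (lin_onZ _ DP hP) // mulN1r.
Qed.

Lemma lin_on_sum D h (I : Type) (s : seq I) (P : pred I) (F : I -> L) :
  lsub D -> lin_on D h -> (forall i, P i -> D (F i)) ->
  h (\sum_(i <- s | P i) F i) = \sum_(i <- s | P i) h (F i).
Proof.
move=> DP hP DF; elim: s => [|i s IH]; first by rewrite !big_nil (lin_on0 DP hP).
rewrite !big_cons; case: ifP => // Pi; rewrite (lin_onD hP) ?IH //; first exact: DF.
exact: lsub_sum.
Qed.

Lemma lin_on_comb D h (I : Type) (s : seq I) (P : pred I) (c : I -> K) (F : I -> L) :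
  lsub D -> lin_on D h -> (forall i, P i -> D (F i)) ->
  h (\sum_(i <- s | P i) c i *: F i) = \sum_(i <- s | P i) c i * h (F i).
Proof.
move=> DP hP DF; rewrite (lin_on_sum _ DP hP); last by move=> i Pi; apply: lsubZ => //; exact: DF.
by apply: eq_bigr => i Pi; rewrite (lin_onZ _ DP hP) //; exact: DF.
Qed.

Lemma lin_on_sub D W h : D `<=` W -> lin_on W h -> lin_on D h.
Proof. by move=> DW hP a x y /DW Wx /DW Wy; exact: hP. Qed.

Lemma lin_on_lin D h h' (a : K) : lin_on D h -> lin_on D h' ->
  lin_on D (fun x => a * h x + h' x).
Proof. by move=> hP hP' c x y Dx Dy /=; rewrite hP // hP' //; ring. Qed.

Lemma lin_on_lcomb D (I : Type) (s : seq I) (P : pred I) (c : I -> K) (F : I -> L -> K) :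
  (forall i, P i -> lin_on D (F i)) ->
  lin_on D (fun x => \sum_(i <- s | P i) c i * F i x).
Proof.
move=> FP a x y Dx Dy; rewrite mulr_sumr -big_split /=.
by apply: eq_bigr => i Pi; rewrite FP //; ring.
Qed.

(** Induction on the number of functionals. The induction hypothesis on the kernel of the last one
    leaves a remainder [h'] that vanishes there, hence a multiple of the last functional. *)
Lemma kernel_comb V (m : nat) (f : 'I_m -> L -> K) h :
  lsub V -> (forall i, lin_on V (f i)) -> lin_on V h ->
  (forall v, V v -> (forall i, f i v = 0) -> h v = 0) ->
  exists c : 'I_m -> K, forall v, V v -> h v = \sum_i c i * f i v.
Proof.
elim: m V f h => [|m IH] V f h VP fP hP hK.
  by exists (fun=> 0) => v Vv; rewrite big_ord0; apply: hK => // -[].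
have wE i : widen_ord (leqnSn m) i = lift ord_max i.
  by apply: val_inj; rewrite /= /bump leqNgt ltn_ord.
pose fm := f ord_max; pose W := V `&` [set x | fm x = 0].
have WP : lsub W by exact: (lsub_ker VP (fP ord_max)).
have WV : W `<=` V by move=> x [].
have [|||c cP] := IH W (fun i => f (widen_ord (leqnSn m) i)) h WP.
- by move=> i; apply: lin_on_sub (fP _).
- exact: lin_on_sub hP.
- move=> v [Vv fmv] fv; apply: hK => // i.
  by case: (unliftP ord_max i) => [j ->|->//]; rewrite -wE; exact: fv.
pose h' v := h v - \sum_(i < m) c i * f (widen_ord (leqnSn m) i) v.
have h'P : lin_on V h'.
  have E : h' = fun v => (-1) * (\sum_(i < m) c i * f (widen_ord (leqnSn m) i) v) + h v.
    by apply/funext => v; rewrite /h' mulN1r addrC.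
  rewrite E; apply: lin_on_lin => //.
  by apply: lin_on_lcomb => i _; exact: fP.
have [[v [Vv fv]]|fm0] := pselect (exists v, V v /\ fm v != 0).
  exists (fun i => if unlift ord_max i is Some j then c j else h' v / fm v) => x Vx.
  rewrite big_ord_recr /= unlift_none -/fm.
  (* The vector is the projection of [x] along [v] onto the kernel of [fm], up to sign. *)
  have hx : h' (fm x / fm v *: v - x) = 0.
    rewrite /h' cP ?subrr //; split; first by apply: lsubB => //; exact: lsubZ.
    rewrite /= /fm (lin_onB VP (fP _)) //; last exact: lsubZ.
    by rewrite (lin_onZ _ VP (fP _)) // -/fm mulfVK ?subrr.
  move: hx; rewrite (lin_onB VP h'P) //; last exact: lsubZ.
  rewrite (lin_onZ _ VP h'P) // => /eqP; rewrite subr_eq0 => /eqP hx.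
  have -> : h x = h' x + \sum_(i < m) c i * f (widen_ord (leqnSn m) i) x by rewrite subrK.
  rewrite -hx [RHS]addrC; congr (_ + _); first by rewrite [RHS]mulrAC -mulrA [LHS]mulrC mulrA.
  apply: eq_bigr => i _; congr (_ * _).
  by rewrite wE liftK.
(* Here the last functional vanishes on [V], so [W] is all of [V] and the last coefficient may be
   0. *)
exists (fun i => if unlift ord_max i is Some j then c j else 0) => x Vx.
rewrite big_ord_recr /= unlift_none mul0r addr0 cP; last first.
  split=> //=; apply: contrapT => fx; apply: fm0; exists x; split=> //.
  exact/eqP.
apply: eq_bigr => i _; congr (_ * _).
by rewrite wE liftK.
Qed.

(** Induction: an interpolant of the first values is corrected along a vector killed by the first
    functionals but not by the last. If there is none, [kernel_comb] makes the last functional a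
    combination of the others, and the compatibility condition forces the last value. *)
Lemma interpolation V (m : nat) (f : 'I_m -> L -> K) (t : 'I_m -> K) :
  lsub V -> (forall i, lin_on V (f i)) ->
  (forall c : 'I_m -> K, (forall v, V v -> \sum_i c i * f i v = 0) ->
     \sum_i c i * t i = 0) ->
  exists2 v, V v & forall i, f i v = t i.
Proof.
elim: m f t => [|m IH] f t VP fP tP; first by exists 0; [case: VP|case].
pose w := widen_ord (leqnSn m).
have wE i : w i = lift ord_max i by apply: val_inj; rewrite /= /bump leqNgt ltn_ord.
have [||v' Vv' v'P] := IH (fun i => f (w i)) (fun i => t (w i)) VP.
- by move=> i; exact: fP.
- move=> c cP; have := tP (fun i => if unlift ord_max i is Some j then c j else 0).
  rewrite big_ord_recr /= unlift_none mul0r addr0.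
  under eq_bigr do rewrite -/(w _) wE liftK -wE.
  apply=> v Vv; rewrite big_ord_recr /= unlift_none mul0r addr0.
  by under eq_bigr do rewrite -/(w _) wE liftK -wE; exact: cP.
have [[v [Vv fv0 fmv]]|nv] := pselect (exists v, [/\ V v, forall i, f (w i) v = 0 & f ord_max v != 0]).
  exists (((t ord_max - f ord_max v') / f ord_max v) *: v + v').
    exact: VP.2.
  move=> i; rewrite fP //; case: (unliftP ord_max i) => [j ->|->].
    by rewrite -wE fv0 mulr0 add0r v'P.
  by rewrite mulfVK // subrK.
have [|||c cP] := @kernel_comb V m (fun i => f (w i)) (f ord_max) VP.
- by move=> i; exact: fP.
- exact: fP.
- by move=> v Vv fv0; apply: contrapT => fv; apply: nv; exists v; split=> //; apply/eqP.
exists v' => // i; case: (unliftP ord_max i) => [j ->|->]; first by rewrite -wE v'P.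
have := tP (fun i => if unlift ord_max i is Some j then - c j else 1).
rewrite big_ord_recr /= unlift_none mul1r.
under eq_bigr do rewrite -/(w _) wE liftK -wE mulNr.
rewrite sumrN addrC => h; apply/eqP; rewrite eq_sym -subr_eq0 cP //.
under eq_bigr do rewrite v'P.
rewrite h // => v Vv; rewrite big_ord_recr /= unlift_none mul1r cP //.
under eq_bigr do rewrite -/(w _) wE liftK -wE mulNr.
by rewrite sumrN addNr.
Qed.
End LinearAlgebra.

(** * Bases adapted to two subspaces *)

Section AdaptedBases.
Context {K : fieldType} {L : lmodType K}.
Implicit Types (P Q W : set L) (s t : seq L).

(** Coefficients depend on the vector and not on its position, so one function serves sublists and
    concatenations; [lfree] therefore includes [uniq]. *)
Definition comb s (c : L -> K) : L := \sum_(v <- s) c v *: v.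
Definition lfree s := uniq s /\ forall c : L -> K, comb s c = 0 -> forall v, v \in s -> c v = 0.
Definition lspan s : set L := [set x | exists c, x = comb s c].
Definition fspan n (w : 'I_n -> L) : set L := [set x | exists c : 'I_n -> K, x = \sum_i c i *: w i].

Lemma fspan_lsub n (w : 'I_n -> L) : lsub (fspan w).
Proof.
split; first by exists (fun=> 0); under eq_bigr do rewrite scale0r; rewrite big1.
move=> a _ _ [c ->] [d ->]; exists (fun i => a * c i + d i).
rewrite scaler_sumr -big_split /=.
by apply: eq_bigr => i _; rewrite scalerDl scalerA.
Qed.

Lemma lspan_lsub s : lsub (lspan s).
Proof.
split; first by exists (fun=> 0); rewrite /comb; under eq_bigr do rewrite scale0r; rewrite big1.
move=> a _ _ [c ->] [d ->]; exists (fun i => a * c i + d i).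
rewrite /comb scaler_sumr -big_split /=.
by apply: eq_bigr => i _; rewrite scalerDl scalerA.
Qed.

Lemma comb_cat s t c : comb (s ++ t) c = comb s c + comb t c.
Proof. by rewrite /comb big_cat. Qed.

Lemma comb_restrict s t c : uniq s -> uniq t -> {subset t <= s} ->
  comb s (fun v => if v \in t then c v else 0) = comb t c.
Proof.
move=> us ut ts; rewrite /comb.
transitivity (\sum_(v <- s | v \in t) c v *: v).
  by rewrite [RHS]big_mkcond; apply: eq_bigr => v _; case: ifP => // _; rewrite scale0r.
rewrite -big_filter; apply: perm_big; apply: uniq_perm => //; first exact: filter_uniq.
move=> v; rewrite mem_filter; case: (boolP (v \in t)) => //= vt.
by rewrite ts.
Qed.

Lemma lspan_mem s v : uniq s -> v \in s -> lspan s v.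
Proof.
move=> us vs; exists (fun u => (u == v)%:R); rewrite /comb (bigD1_seq v) //= eqxx scale1r.
by rewrite big1_seq ?addr0 // => u /andP[/negbTE-> _]; rewrite scale0r.
Qed.

Lemma lspan_sub s W : lsub W -> {subset s <= W} -> lspan s `<=` W.
Proof.
move=> WP sW _ [c ->]; rewrite /comb big_seq; apply: lsub_sum => // v vs.
by apply: lsubZ => //; apply: set_mem; exact: sW.
Qed.

Lemma lfree_coef0 s t c : lfree s -> uniq t -> {subset t <= s} ->
  lspan t (comb s c) -> forall v, v \in s -> v \notin t -> c v = 0.
Proof.
move=> [us sf] ut ts [d cd] v vs vt.
have := sf (fun v => c v - (if v \in t then d v else 0)).
rewrite {1}/comb; under eq_bigr do rewrite scalerBl.
rewrite sumrB -/(comb s c) -/(comb s (fun v => if v \in t then d v else 0)).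
rewrite comb_restrict // cd subrr => /(_ erefl _ vs).
by rewrite (negbTE vt) subr0.
Qed.

Lemma lfree_cons s x : lfree s -> ~ lspan s x -> lfree (x :: s).
Proof.
move=> [us sf] sx; have xs : x \notin s by apply/negP => /(lspan_mem us).
split=> [/=|c]; first by rewrite xs.
rewrite /comb big_cons => c0.
have cx : c x = 0.
  apply: contrapT => /eqP cx; apply: sx.
  have [_ sP] := lspan_lsub s.
  have -> : x = - (c x)^-1 *: comb s c.
    rewrite -[comb s c]add0r -(addNr (c x *: x)) -addrA c0 addr0.
    by rewrite scaleNr scalerN opprK scalerA mulVf // scale1r.
  by apply: (lsubZ _ (lspan_lsub s)); exists c.
move=> v; rewrite in_cons => /orP[/eqP->//|]; apply: sf.
by move: c0; rewrite cx scale0r add0r.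
Qed.

Lemma lfree_size n (w : 'I_n -> L) s : lfree s ->
  (forall v, v \in s -> fspan w v) -> (size s <= n)%N.
Proof.
move=> [us sf] sw; rewrite leqNgt; apply/negP => ns.
have /choice[A AP] (v : L) : exists c : 'I_n -> K, v \in s -> v = \sum_i c i *: w i.
  have [vs|] := boolP (v \in s); last by exists (fun=> 0).
  by have [c cP] := sw _ vs; exists c.
pose B : 'M[K]_(size s, n) := \matrix_(i, j) A (nth 0 s i) j.
(* [B] has more rows than columns, so some nonzero row [u] satisfies [u *m B = 0]: a nontrivial
   relation between the vectors of [s]. *)
have : kermx B != 0.
  rewrite -mxrank_eq0 mxrank_ker subn_eq0 -ltnNge.
  by apply: leq_ltn_trans ns; exact: rank_leq_col.
case/rowV0Pn => u /sub_kermxP uB u0.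
pose c v := if insub (index v s) is Some i then u 0 i else 0.
have cE (i : 'I_(size s)) : c (nth 0 s i) = u 0 i.
  by rewrite /c index_uniq // valK.
have c0 : comb s c = 0.
  rewrite /comb (big_nth 0) big_mkord.
  transitivity (\sum_(j < n) (u *m B) 0 j *: w j).
    under [RHS]eq_bigr do rewrite mxE scaler_suml.
    rewrite exchange_big /=; apply: eq_bigr => i _; rewrite cE {1}(AP _ (mem_nth 0 (ltn_ord i))).
    by rewrite scaler_sumr; apply: eq_bigr => j _; rewrite scalerA mxE.
  by rewrite uB big1 // => j _; rewrite mxE scale0r.
case/negP: u0; apply/eqP/rowP => i; rewrite mxE -cE.
by apply: (sf _ c0); exact: mem_nth.
Qed.

(** Vectors of [W] in the span of [w] are added as long as one is independent of the list;
    [lfree_size] bounds the length by [n], whence the induction on [n - size s]. *)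
Lemma lfree_extend n (w : 'I_n -> L) W s : lfree s ->
  (forall v, v \in s -> fspan w v) ->
  exists t, [/\ forall v, v \in t -> W v, lfree (t ++ s),
    forall v, v \in t -> fspan w v & forall x, W x -> fspan w x -> lspan (t ++ s) x].
Proof.
have [k] := ubnP (n - size s); elim: k s => // k IH s sk sf sw.
have [[x [Wx wx sx]]|nx] := pselect (exists x, [/\ W x, fspan w x & ~ lspan s x]); last first.
  exists [::]; split=> //= x Wx wx; apply: contrapT => sx; apply: nx.
  by exists x.
have xsf := lfree_cons sf sx.
have xsw v : v \in x :: s -> fspan w v.
  by rewrite in_cons => /orP[/eqP->//|]; exact: sw.
have [|t [tW tf tw tspan]] := IH (x :: s) _ xsf xsw.
  have := lfree_size xsf xsw => /= ns.
  by rewrite subnS prednK ?subn_gt0 // -ltnS.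
exists (rcons t x); rewrite cat_rcons; split=> // v;
  rewrite mem_rcons in_cons => /orP[/eqP->//|]; [exact: tW|exact: tw].
Qed.

(** Inside the span of [w]: [s0] is a basis of the intersection of [P] and [Q], [s1] completes it to
    a basis of [P], [s2] adds what [Q] needs, and [s3] the rest. *)
Lemma adapted_seq n (w : 'I_n -> L) P Q : lsub P -> lsub Q ->
  exists s, [/\ lfree s, forall v, v \in s -> fspan w v, fspan w `<=` lspan s,
    forall c, P (comb s c) -> forall v, v \in s -> c v != 0 -> P v &
    forall c, Q (comb s c) -> forall v, v \in s -> c v != 0 -> Q v].
Proof.
move=> PP QP; have wP := fspan_lsub w.
have nilf : lfree [::] by split.
have [//|s0 []] := @lfree_extend n w (P `&` Q) [::] nilf; rewrite cats0 => s0W s0f s0w s0span.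
have [//|s1 [s1W s1f s1w s1span]] := @lfree_extend n w P s0 s0f.
have [|s2 [s2W s2f s2w s2span]] := @lfree_extend n w Q (s1 ++ s0) s1f.
  by move=> v; rewrite mem_cat => /orP[/s1w|/s0w].
have sw v : v \in s2 ++ s1 ++ s0 -> fspan w v.
  by rewrite !mem_cat => /or3P[/s2w|/s1w|/s0w].
have [//|s3 [_ sf s3w s3span]] := @lfree_extend n w setT (s2 ++ s1 ++ s0) s2f.
pose s := s3 ++ s2 ++ s1 ++ s0.
have {}sw v : v \in s -> fspan w v.
  by rewrite /s mem_cat => /orP[/s3w|/sw].
have combw c : fspan w (comb s c).
  by apply: (@lspan_sub s) => //; [move=> v vs; apply/mem_set/sw|exists c].
exists s; split=> //; first by move=> x wx; exact: s3span.
  move=> c Pc v vs; apply: contra_neqP => Pv.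
  apply: (lfree_coef0 (s := s) (t := s1 ++ s0)) => //; first by case: s1f.
  - by move=> u; rewrite /s !mem_cat => /orP[] ->; rewrite !orbT.
  - exact: s1span.
  - by apply/negP; rewrite mem_cat => /orP[/s1W//|/s0W[]].
move=> c Qc v vs; apply: contra_neqP => Qv.
have [d cd] := s2span _ Qc (combw c).
have s2s1s0u : uniq (s2 ++ s1 ++ s0) by case: s2f.
have s1s0u : uniq (s1 ++ s0) by case: s1f.
have s1u : uniq s1 by move: s1s0u; rewrite cat_uniq => /and3P[].
have s0u : uniq s0 by case: s0f.
have s2s0u : uniq (s2 ++ s0).
  move: s2s1s0u; rewrite !cat_uniq => /and5P[-> h _ _ ->]; rewrite andbT /=.
  by apply: contra h => /hasP[u us0 us2]; apply/hasP; exists u => //; rewrite mem_cat us0 orbT.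
(* The part of a vector of [Q] along [s1] lies in [P], and in [Q] by difference, hence in the span
   of [s0]; freeness of [s1 ++ s0] makes it zero. *)
have s1d v' : v' \in s1 -> d v' = 0.
  have combs (s' : seq L) (W : set L) : lsub W -> (forall u, u \in s' -> W u) -> W (comb s' d).
    by move=> WP sW; apply: (@lspan_sub s') => //; [move=> u us; apply/mem_set/sW|exists d].
  have : lspan s0 (comb s1 d).
    apply: s0span; last exact: combs s1w.
    split; first exact: combs s1W.
    have -> : comb s1 d = comb s c - comb s2 d - comb s0 d.
      by rewrite cd !comb_cat (addrC (comb s2 d)) addrK addrK.
    apply: lsubB => //; first by apply: lsubB => //; exact: combs s2W.
    by apply: combs => // u /s0W[].
  rewrite -(@comb_restrict (s1 ++ s0) s1) //; last by move=> u us; rewrite mem_cat us.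
  move=> h vs1.
  have s01 : {subset s0 <= s1 ++ s0} by move=> u us; rewrite mem_cat us orbT.
  have := lfree_coef0 s1f s0u s01 h (v := v'); rewrite mem_cat vs1 /=; apply=> //.
  move: s1s0u; rewrite cat_uniq => /and3P[_ + _]; apply: contra => us0.
  by apply/hasP; exists v'.
apply: (lfree_coef0 (s := s) (t := s2 ++ s0)) => //.
- by move=> u; rewrite /s !mem_cat => /orP[] ->; rewrite !orbT.
- exists d; rewrite cd !comb_cat [comb s1 d]big1_seq ?add0r //.
  by move=> u /andP[_ /s1d->]; rewrite scale0r.
- by apply/negP; rewrite mem_cat => /orP[/s2W//|/s0W[]].
Qed.

Definition ffree n (z : 'I_n -> L) :=
  forall c : 'I_n -> K, \sum_i c i *: z i = 0 -> forall i, c i = 0.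

Lemma adapted_basis n (w : 'I_n -> L) P Q : lsub P -> lsub Q ->
  exists (m : nat) (z : 'I_m -> L), [/\ ffree z, forall i, fspan w (z i),
    fspan w `<=` fspan z,
    forall c, P (\sum_i c i *: z i) -> forall i, c i != 0 -> P (z i) &
    forall c, Q (\sum_i c i *: z i) -> forall i, c i != 0 -> Q (z i)].
Proof.
move=> PP QP; have [s [[us sf] sw ws sP sQ]] := adapted_seq w PP QP.
exists (size s), (fun i => nth 0 s i).
have cE (c : 'I_(size s) -> K) : exists2 d : L -> K,
    \sum_i c i *: nth 0 s i = comb s d & forall i : 'I_(size s), d (nth 0 s i) = c i.
  pose d v := if insub (index v s) is Some i then c i else 0.
  have dE (i : 'I_(size s)) : d (nth 0 s i) = c i by rewrite /d index_uniq // valK.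
  exists d => //; rewrite /comb (big_nth 0) big_mkord.
  by apply: eq_bigr => i _; rewrite dE.
split=> [c|i|x /ws[c ->]|c|c].
- by have [d -> dE] := cE c => d0 i; rewrite -dE; apply: sf => //; exact: mem_nth.
- by apply: sw; exact: mem_nth.
- by exists (fun i : 'I_(size s) => c (nth 0 s i)); rewrite /comb (big_nth 0) big_mkord.
- have [d -> dE] := cE c => d0 i; rewrite -dE => di; apply: sP d0 _ _ di.
  exact: mem_nth.
- have [d -> dE] := cE c => d0 i; rewrite -dE => di; apply: sQ d0 _ _ di.
  exact: mem_nth.
Qed.
End AdaptedBases.

(** * The Hahn-Banach theorem *)

Section HahnBanach.
Context {R : realType} {b : bool}.
Local Notation K := (bscalar R b).
Context {L : lmodType K}.
Implicit Types (D M : set L) (p q : L -> R) (r : R) (x : L).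

Definition rsublin D p := [/\ p 0 = 0,
  forall x y, D x -> D y -> p (x + y) <= p x + p y &
  forall r x, 0 < r -> D x -> p (emb b r *: x) <= r * p x].

Lemma emb_lsub D r x : lsub D -> D x -> D (emb b r *: x).
Proof. exact: lsubZ. Qed.

Lemma embVK r x : r != 0 -> emb b r^-1 *: (emb b r *: x) = x.
Proof. by move=> r0; rewrite scalerA -embM mulVf // emb1 scale1r. Qed.

Lemma rsublinZ D p r x : lsub D -> rsublin D p -> 0 <= r -> D x ->
  p (emb b r *: x) = r * p x.
Proof.
move=> DP [p0 pD pZ]; rewrite le_eqVlt => /predU1P[<- Dx|r0 Dx].
  by rewrite emb0 scale0r mul0r.
apply/eqP; rewrite eq_le pZ //=.
have := pZ r^-1 (emb b r *: x); rewrite embVK ?gt_eqF // invr_gt0 => /(_ r0 (emb_lsub _ DP Dx)).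
by rewrite mulrC ler_pdivlMr // mulrC.
Qed.

(** Common source of two infima: over a half-line when a functional is slid, and over a chain in
    Zorn's lemma. Sublinearity only needs that sums and positive multiples be absorbed by a change
    of index. *)
Lemma rsublin_inf D (I : Type) (A : set I) (F : I -> L -> R) : A !=set0 ->
  (forall x, D x -> exists m, forall i, A i -> m <= F i x) ->
  lsub D ->
  (forall i, A i -> F i 0 = 0) ->
  (forall i j x y, A i -> A j -> D x -> D y ->
     exists2 k, A k & F k (x + y) <= F i x + F j y) ->
  (forall r i x, 0 < r -> A i -> D x ->
     exists2 k, A k & F k (emb b r *: x) <= r * F i x) ->
  rsublin D (fun x => inf [set F i x | i in A]) /\
  forall x i, D x -> A i -> inf [set F i x | i in A] <= F i x.
Proof.
move=> [i0 Ai0] Flb DP F0 FD FZ.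
have ne x : [set F i x | i in A] !=set0 by exists (F i0 x), i0.
have le x i : D x -> A i -> inf [set F i x | i in A] <= F i x.
  move=> Dx Ai; apply: ge_inf; last by exists i.
  by have [m mP] := Flb _ Dx; exists m => _ [j Aj <-]; exact: mP.
split=> //; split.
- rewrite (_ : [set F i 0 | i in A] = [set 0]) ?inf1 //.
  by apply/seteqP; split=> [_ [i Ai <-]|_ ->]; [exact: F0|exists i0 => //; exact: F0].
- move=> x y Dx Dy; have Dxy := lsubD DP Dx Dy.
  rewrite -lerBlDr; apply: lb_le_inf => // _ [i Ai <-].
  rewrite lerBlDr -lerBlDl; apply: lb_le_inf => // _ [j Aj <-].
  have [k Ak kP] := FD _ _ _ _ Ai Aj Dx Dy.
  by rewrite lerBlDl; apply: le_trans (le _ _ Dxy Ak) kP.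
- move=> r x r0 Dx; have Drx := emb_lsub r DP Dx.
  rewrite mulrC -ler_pdivrMr //; apply: lb_le_inf => // _ [i Ai <-].
  have [k Ak kP] := FZ _ _ _ r0 Ai Dx.
  by rewrite ler_pdivrMr // mulrC; apply: le_trans (le _ _ Drx Ak) kP.
Qed.

Lemma rsublin_ge D p x : lsub D -> rsublin D p -> D x -> - p (- x) <= p x.
Proof.
move=> DP [p0 pD _] Dx; have := pD x (- x) Dx (lsubN DP Dx).
by rewrite subrr p0; lra.
Qed.

(** Take [q' y], the infimum over [t >= 0] of [q (y + t x) - t q x], bounded below by [- q (- y)].
    The values [t = 0] and [t = 1] give the two bounds. *)
Lemma rsublin_slide D q x : lsub D -> rsublin D q -> D x ->
  exists q', [/\ rsublin D q', forall y, D y -> q' y <= q y &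
    forall y, D y -> q' y <= q (y + x) - q x].
Proof.
move=> DP qP Dx; have [q0 qD qZ] := qP.
pose F (t : R) y := q (y + emb b t *: x) - t * q x.
have Dt t y : D y -> D (y + emb b t *: x).
  by move=> Dy; apply: lsubD => //; exact: emb_lsub.
have [||||||q'P q'le] := @rsublin_inf D R [set t | 0 <= t] F.
- by exists 0 => /=.
- move=> y Dy; exists (- q (- y)) => t /= t0; rewrite /F.
  have := qD (y + emb b t *: x) (- y) (Dt _ _ Dy) (lsubN DP Dy).
  by rewrite addrC addKr (rsublinZ DP qP t0 Dx); lra.
- by [].
- by move=> t /= t0; rewrite /F add0r (rsublinZ DP qP t0 Dx) subrr.
- move=> s t y z /= s0 t0 Dy Dz; exists (s + t); rewrite /= ?addr_ge0 // /F.
  rewrite embD scalerDl (addrACA y z).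
  by have := qD _ _ (Dt s _ Dy) (Dt t _ Dz); lra.
- move=> r t y r0 /= t0 Dy; exists (r * t); rewrite /= ?mulr_ge0 ?(ltW r0) // /F.
  rewrite embM -scalerA -scalerDr.
  by have := qZ _ _ r0 (Dt t _ Dy); lra.
exists (fun y => inf [set F t y | t in [set t | 0 <= t]]); split=> // y Dy.
  by have /= := q'le _ 0 Dy (lexx 0); rewrite /F emb0 scale0r addr0 mul0r subr0.
by have /= := q'le _ 1 Dy ler01; rewrite /F emb1 scale1r mul1r.
Qed.

(** Zorn's lemma: a chain is bounded by its pointwise infimum, finite because a sublinear functional
    below [p] is at least [- p (- x)] at [x]. *)
Lemma rsublin_minimal D p : lsub D -> rsublin D p ->
  exists q, [/\ rsublin D q, forall x, D x -> q x <= p x &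
    forall q', rsublin D q' -> (forall x, D x -> q' x <= q x) ->
      forall x, D x -> q x <= q' x].
Proof.
move=> DP pP.
pose T := {q : L -> R | rsublin D q /\ forall x, D x -> q x <= p x}.
(* The order is reversed, so that maximal elements are minimal functionals. *)
pose le (s t : T) := `[< forall x, D x -> sval t x <= sval s x >].
have t0 : T by exists p; split.
have [|||t tP] := @ZL_preorder T t0 le.
- by move=> t; apply/asboolP.
- move=> r s t /asboolP rs /asboolP st; apply/asboolP => x Dx.
  by apply: le_trans (st _ Dx) (rs _ Dx).
- move=> A Atot; have [[a Aa]|A0] := pselect (A !=set0); last first.
    by exists t0 => s As; case: A0; exists s.
  have [||||||qP qle] := @rsublin_inf D T A (fun s => sval s).
  + by exists a.
  + move=> x Dx; exists (- p (- x)) => -[s [sP sp]] _ /=.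
    have := rsublin_ge DP sP Dx; have := sp _ (lsubN DP Dx); lra.
  + by [].
  + by move=> [s [[]]].
  + move=> [s [sP sp]] [t [tP tp]] x y As At Dx Dy.
    have [_ sD _] := sP; have [_ tD _] := tP.
    have [/asboolP h|/asboolP h] := Atot _ _ As At.
      exists (exist _ t (conj tP tp)) => //=.
      by apply: le_trans (tD _ _ Dx Dy) _; rewrite lerD2r; exact: h.
    exists (exist _ s (conj sP sp)) => //=.
    by apply: le_trans (sD _ _ Dx Dy) _; rewrite lerD2l; exact: h.
  + move=> r [s [sP sp]] x r0 As Dx; exists (exist _ s (conj sP sp)) => //=.
    by have [_ _] := sP; apply.
  have qp x : D x -> inf [set sval i x | i in A] <= p x.
    by move=> Dx; apply: le_trans (qle _ _ Dx Aa) ((svalP a).2 _ Dx).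
  pose q : T := exist (fun q => rsublin D q /\ forall x, D x -> q x <= p x) _ (conj qP qp).
  exists q => s As; apply/asboolP => x Dx /=.
  exact: qle.
case: t tP => q [qP qp] tP; exists q; split=> // q' q'P q'q x Dx.
have q'p y : D y -> q' y <= p y by move=> Dy; apply: le_trans (q'q _ Dy) (qp _ Dy).
by have /asboolP := tP (exist _ q' (conj q'P q'p)) (introT (asboolP _) q'q); exact.
Qed.

(* A minimal sublinear functional is linear, since sliding it along [x] does not
   decrease it; sliding along [x0] first forces the value at [x0]. *)
Lemma real_Hahn_Banach D p x0 : lsub D -> rsublin D p -> D x0 ->
  exists u : L -> R, [/\ forall x y, D x -> D y -> u (x + y) = u x + u y,
    forall r x, D x -> u (emb b r *: x) = r * u x,
    forall x, D x -> u x <= p x & p x0 <= u x0].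
Proof.
move=> DP pP Dx0.
have [p1 [p1P p1p p1x]] := rsublin_slide DP pP Dx0.
have [q [qP qp1 qmin]] := rsublin_minimal DP p1P.
have [q0 qD qZ] := qP.
have qadd x y : D x -> D y -> q (x + y) = q x + q y.
  move=> Dx Dy; apply/eqP; rewrite eq_le qD //=.
  have [q' [q'P q'q q'x]] := rsublin_slide DP qP Dx.
  have h1 := qmin _ q'P q'q _ Dy; have := q'x _ Dy.
  by rewrite [y + x]addrC; lra.
have qN x : D x -> q (- x) = - q x.
  move=> Dx; have := qadd _ _ Dx (lsubN DP Dx).
  by rewrite subrr q0; lra.
exists q; split=> // [r x Dx|x Dx|].
- have [r0|r0] := leP 0 r; first exact: (rsublinZ DP qP).
  rewrite -[r]opprK embN scaleNr qN; last exact: emb_lsub.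
  by rewrite (rsublinZ DP qP) ?mulNr // oppr_ge0 ltW.
- by apply: le_trans (qp1 _ Dx) (p1p _ Dx).
- have DNx := lsubN DP Dx0.
  have := qp1 _ DNx; have := p1x _ DNx; rewrite qN // addNr.
  by case: pP => -> _ _; lra.
Qed.

(** Relative to a domain, because dual spaces appear as subspaces of full function spaces and the
    dual norm is meaningful only on them. *)
Definition snorm D p := [/\ forall x, D x -> 0 <= p x,
  forall x y, D x -> D y -> p (x + y) <= p x + p y &
  forall a x, D x -> p (a *: x) <= nrm a * p x].

Lemma snorm0 D p : D 0 -> snorm D p -> p 0 = 0.
Proof.
move=> D0 [p0 _ pZ]; apply/eqP; rewrite eq_le p0 // andbT.
by have := pZ 0 0 D0; rewrite nrm0 mul0r scale0r.
Qed.

Lemma snorm_rsublin D p : D 0 -> snorm D p -> rsublin D p.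
Proof.
move=> D0 pP; have [p0 pD pZ] := pP; split=> //; first exact: snorm0 pP.
by move=> r x r0 Dx; apply: le_trans (pZ _ _ Dx) _; rewrite nrm_emb // ltW.
Qed.

Lemma snorm_sum D p (I : Type) (s : seq I) (P : pred I) (F : I -> L) :
  lsub D -> snorm D p -> (forall i, P i -> D (F i)) ->
  p (\sum_(i <- s | P i) F i) <= \sum_(i <- s | P i) p (F i).
Proof.
move=> DP pP DF; elim: s => [|i s IH]; first by rewrite !big_nil (snorm0 DP.1 pP).
rewrite !big_cons; case: ifP => // Pi; have [_ pD _] := pP.
by apply: le_trans (pD _ _ (DF _ Pi) (lsub_sum _ DP DF)) _; rewrite lerD2l.
Qed.
End HahnBanach.

(** The Bohnenblust-Sobczyk device: in the complex case [u x - i u (i x)] is complex linear with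
    real part [u]. *)
Lemma real_part_extension (R : realType) (b : bool) (L : lmodType (bscalar R b))
    (D : set L) (u : L -> R) : lsub D ->
  (forall x y, D x -> D y -> u (x + y) = u x + u y) ->
  (forall (r : R) x, D x -> u (emb b r *: x) = r * u x) ->
  exists2 h : L -> bscalar R b, lin_on D h & forall x, D x -> rep (h x) = u x.
Proof.
case: b L D u => L D u DP uD uZ; last first.
  exists u => // a x y Dx Dy; rewrite uD //; first by congr (_ + _); exact: uZ.
  exact: lsubZ.
pose i : bscalar R true := ('i)%C.
exists (fun x => (u x -i* u (i *: x))%C) => // a x y Dx Dy.
have Di z : D z -> D (i *: z) by exact: lsubZ.
have aE z : D z -> u (a *: z) = complex.Re a * u z + complex.Im a * u (i *: z).
  move=> Dz; have -> : a *: z = emb true (complex.Re a) *: z + emb true (complex.Im a) *: (i *: z).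
    rewrite scalerA -scalerDl; congr (_ *: _); rewrite {1}[a]complexE.
    by congr (_ + _); rewrite mulrC.
  by rewrite uD ?uZ //; [exact: Di|exact: lsubZ|apply: lsubZ => //; exact: Di].
have ii z : i *: (i *: z) = - z.
  rewrite scalerA -scaleN1r; congr (_ *: _).
  by have := sqr_i R; rewrite expr2.
have uN z : D z -> u (- z) = - u z.
  move=> Dz; have := uZ (-1) z Dz; rewrite embN emb1 scaleN1r mulN1r; exact.
rewrite scalerDr scalerA [i * a]mulrC -scalerA !uD //; try exact: lsubZ.
  rewrite !aE //; last exact: Di.
  rewrite ii uN //; case: (a) => p q /=.
  apply/eqP; rewrite eq_complex /=; apply/andP; split; apply/eqP; ring.
by apply: lsubZ => //; exact: Di.
Qed.

Section HahnBanachK.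
Context {R : realType} {b : bool}.
Local Notation K := (bscalar R b).
Context {L : lmodType K}.
Implicit Types (D M : set L) (p q : L -> R) (r : R) (x : L).

Lemma Hahn_Banach D p x0 : lsub D -> snorm D p -> D x0 ->
  exists h : L -> K, [/\ lin_on D h, forall x, D x -> nrm (h x) <= p x &
    nrm (h x0) = p x0].
Proof.
move=> DP pP Dx0; have [p0 pD pZ] := pP.
have [u [uD uZ up ux0]] := real_Hahn_Banach DP (snorm_rsublin DP.1 pP) Dx0.
have [h hP hu] := real_part_extension DP uD uZ.
have hp x : D x -> nrm (h x) <= p x.
  move=> Dx; have [t t1 tE] := rotate (h x).
  have Dtx := lsubZ t DP Dx.
  rewrite -(repK (b := b) (nrm (h x))) -tE -(lin_onZ _ DP hP Dx) hu //.
  by apply: le_trans (up _ Dtx) _; rewrite -[leRHS]mul1r -t1; exact: pZ.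
exists h; split=> //; apply/eqP; rewrite eq_le hp //=.
by apply: le_trans ux0 _; rewrite -hu //; exact: rep_le_nrm.
Qed.

(** Hahn-Banach for the quotient seminorm [P], the distance to [M]: it vanishes on [M] and is at
    least [r] at [x0]. *)
Lemma Hahn_Banach_distance D p M x0 r : lsub D -> snorm D p ->
  lsub M -> M `<=` D -> D x0 -> (forall m, M m -> r <= p (x0 + m)) ->
  exists h : L -> K, [/\ lin_on D h, forall x, D x -> nrm (h x) <= p x,
    forall m, M m -> h m = 0 & r <= nrm (h x0)].
Proof.
move=> DP pP MP MD Dx0 rM; have [p0 pD pZ] := pP; have M0 := MP.1.
pose P x := inf [set p (x + m) | m in M].
have DM x m : D x -> M m -> D (x + m) by move=> Dx /MD Dm; exact: lsubD.
have ne x : [set p (x + m) | m in M] !=set0 by exists (p (x + 0)), 0.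
have le x m : D x -> M m -> P x <= p (x + m).
  move=> Dx Mm; apply: ge_inf; last by exists m.
  by exists 0 => _ [m' Mm' <-]; apply/p0/DM.
have P0 x : D x -> 0 <= P x.
  by move=> Dx; apply: lb_le_inf => // _ [m Mm <-]; apply/p0/DM.
have PP : snorm D P.
  split=> // [x y Dx Dy|a x Dx].
    rewrite -lerBlDr; apply: lb_le_inf => // _ [m Mm <-].
    rewrite lerBlDr -lerBlDl; apply: lb_le_inf => // _ [m' Mm' <-].
    rewrite lerBlDl; apply: le_trans (le _ _ (lsubD DP Dx Dy) (lsubD MP Mm Mm')) _.
    by rewrite addrACA; apply: pD; exact: DM.
  have Dax := lsubZ a DP Dx.
  have [->|a0] := eqVneq a 0.
    rewrite scale0r nrm0 mul0r; apply: le_trans (le _ _ DP.1 M0) _.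
    by rewrite addr0 (snorm0 DP.1 pP).
  have na0 : 0 < nrm a.
    by rewrite lt_def nrm_ge0 andbT; apply: contra_neq a0; exact: nrm_eq0.
  rewrite mulrC -ler_pdivrMr //; apply: lb_le_inf => // _ [m Mm <-].
  rewrite ler_pdivrMr // mulrC; apply: le_trans (le _ _ Dax (lsubZ a MP Mm)) _.
  by rewrite -scalerDr; apply/pZ/DM.
have [h [hP hp hx0]] := Hahn_Banach DP PP Dx0.
exists h; split=> // [x Dx|m Mm|].
- by apply: le_trans (hp _ Dx) _; have := le _ _ Dx M0; rewrite addr0.
- apply: nrm_eq0; apply/eqP; rewrite eq_le nrm_ge0 andbT.
  apply: le_trans (hp _ (MD _ Mm)) _; apply: le_trans (le _ _ (MD _ Mm) (lsubN MP Mm)) _.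
  by rewrite subrr (snorm0 DP.1 pP).
- by rewrite hx0; apply: lb_le_inf => // _ [m Mm <-]; exact: rM.
Qed.
End HahnBanachK.

(** * A simultaneous Helly theorem *)

Section SeminormedDual.
Context {R : realType} {b : bool}.
Local Notation K := (bscalar R b).
Context {L : lmodType K}.
Variables (D : set L) (q : L -> R).

(* As in [bidual], functionals are normalised to vanish off their domain. *)
Definition sdual : set (L -> K^o) := [set h | [/\ lin_on D h,
  exists M : R, forall x, D x -> nrm (h x) <= M * q x &
  forall x, ~ D x -> h x = 0]].

Definition dualnorm (h : L -> K) : R := sup [set nrm (h x) | x in [set x | D x /\ q x <= 1]].

Hypotheses (DP : lsub D) (qP : snorm D q).

Let hs (h : L -> K) : sdual h -> has_sup [set nrm (h x) | x in [set x | D x /\ q x <= 1]].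
Proof.
move=> [hP [M hM] _]; have [q0 _ _] := qP; split.
  by exists (nrm (h 0)), 0 => //; split; [case: DP|rewrite (snorm0 DP.1 qP)].
exists `|M| => _ [x [Dx qx] <-]; apply: le_trans (hM _ Dx) _.
apply: le_trans (_ : `|M| * q x <= _); first by rewrite ler_wpM2r ?q0 ?ler_norm.
by rewrite ler_piMr.
Qed.

Lemma dualnorm_ge0 h : sdual h -> 0 <= dualnorm h.
Proof.
move=> hD; apply: le_trans (nrm_ge0 (h 0)) _; apply: (ub_le_sup (hs hD).2).
by exists 0 => //; split; [case: DP|rewrite (snorm0 DP.1 qP)].
Qed.

Lemma dualnorm_ub h x : sdual h -> D x -> q x <= 1 -> nrm (h x) <= dualnorm h.
Proof. by move=> hD Dx qx; apply: (ub_le_sup (hs hD).2); exists x. Qed.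

Lemma dualnormP h x : sdual h -> D x -> nrm (h x) <= dualnorm h * q x.
Proof.
move=> hD Dx; have [hP [M hM] _] := hD; have [q0 _ qZ] := qP.
(* [q] is only a seminorm. Where it vanishes [x] cannot be normalised, but boundedness of [h] gives
   [h x = 0]. *)
have := q0 _ Dx; rewrite le_eqVlt => /predU1P[qx|qx].
  by rewrite -qx mulr0; have := hM _ Dx; rewrite -qx mulr0.
have Dx' := lsubZ (emb b (q x)^-1) DP Dx.
have q1 : q (emb b (q x)^-1 *: x) <= 1.
  apply: le_trans (qZ _ _ Dx) _; rewrite nrm_emb ?invr_ge0 ?(ltW qx) //.
  by rewrite mulVf // gt_eqF.
have := dualnorm_ub hD Dx' q1; rewrite (lin_onZ _ DP hP Dx) nrmM nrm_emb ?invr_ge0 ?(ltW qx) //.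
by rewrite -ler_pdivrMr // mulrC.
Qed.

Lemma dualnorm_le h M : sdual h -> (forall x, D x -> q x <= 1 -> nrm (h x) <= M) ->
  dualnorm h <= M.
Proof.
move=> hD hM; apply: ge_sup; first by case: (hs hD).
by move=> _ [x [Dx qx] <-]; exact: hM.
Qed.

Lemma dualnorm_approx h e : sdual h -> 0 < e ->
  exists x, [/\ D x, q x <= 1 & dualnorm h - e < nrm (h x)].
Proof.
move=> hD e0; have [_ [x [Dx qx] <-] lt] := sup_adherent e0 (hs hD).
by exists x.
Qed.

Lemma sdual_lsub : lsub sdual.
Proof.
split.
  split=> [a x y _ _||//]; first by rewrite /= mulr0 addr0.
  by exists 0 => x Dx; rewrite /= nrm0 mul0r.
move=> a h k [hP [M hM] h0] [kP [N kN] k0]; split.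
- exact: lin_on_lin.
- exists (nrm a * M + N) => x Dx; apply: le_trans (nrmD _ _) _.
  rewrite nrmM mulrDl -mulrA lerD ?ler_wpM2l ?nrm_ge0 //; [exact: hM|exact: kN].
- by move=> x nx; rewrite /= !fctE h0 // k0 // scaler0 addr0.
Qed.

Lemma dualnorm_snorm : snorm sdual dualnorm.
Proof.
split=> [h|h k hD kD|a h hD]; first exact: dualnorm_ge0.
- apply: dualnorm_le; first exact: (lsubD sdual_lsub).
  move=> x Dx qx; apply: le_trans (nrmD _ _) _.
  by rewrite lerD // dualnorm_ub.
- apply: dualnorm_le; first exact: (lsubZ _ sdual_lsub).
  by move=> x Dx qx; rewrite nrmM ler_wpM2l ?nrm_ge0 // dualnorm_ub.
Qed.

Lemma dualnorm_eq0 h : sdual h -> dualnorm h = 0 -> h = 0.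
Proof.
move=> hD h0; apply/funext => x; have [Dx|nx] := pselect (D x); last by case: hD => _ _ ->.
apply: nrm_eq0; apply/eqP; rewrite eq_le nrm_ge0 andbT.
by have := dualnormP hD Dx; rewrite h0 mul0r.
Qed.
End SeminormedDual.

(** * Functionals on a finite power with the maximum norm *)

Section MaxNorm.
Context {R : realType} {b : bool}.
Local Notation K := (bscalar R b).
Context {L : lmodType K} {I : finType}.
Variables (D : set L) (q : L -> R).
Hypotheses (DP : lsub D) (qP : snorm D q).

Definition pdom : set (I -> L) := [set u | forall k, D (u k)].
Definition pnorm (u : I -> L) : R := \big[Num.max/0]_k q (u k).
Definition single (k : I) (x : L) : I -> L := fun i => if i == k then x else 0.

Lemma pdom_lsub : lsub pdom.
Proof. by have [D0 DA] := DP; split=> [k|a u v Du Dv k]; [exact: D0|exact: DA]. Qed.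

Lemma pnorm_le u M : 0 <= M -> (forall k, q (u k) <= M) -> pnorm u <= M.
Proof. by move=> M0 uM; apply: bigmax_le => // k _; exact: uM. Qed.

Lemma le_pnorm u k : q (u k) <= pnorm u.
Proof. exact: le_bigmax. Qed.

Lemma pnorm_snorm : snorm pdom pnorm.
Proof.
have [q0 qD qZ] := qP; have p0 u : 0 <= pnorm u by exact: bigmax_ge_id.
split=> // [u v Du Dv|a u Du].
  apply: pnorm_le => [|k]; first by rewrite addr_ge0.
  apply: le_trans (qD _ _ (Du k) (Dv k)) _.
  by apply: lerD; exact: le_pnorm.
apply: pnorm_le => [|k]; first by rewrite mulr_ge0 ?nrm_ge0.
by apply: le_trans (qZ _ _ (Du k)) _; rewrite ler_wpM2l ?nrm_ge0 ?le_pnorm.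
Qed.

Lemma single_pdom k x : D x -> pdom (single k x).
Proof. by move=> Dx i; rewrite /single; case: ifP => // _; case: DP. Qed.

Lemma pnorm_single k x : D x -> pnorm (single k x) <= q x.
Proof.
move=> Dx; have [q0 _ _] := qP; apply: pnorm_le => [|i]; first exact: q0.
by rewrite /single; case: ifP => // _; rewrite (snorm0 DP.1 qP) q0.
Qed.

Lemma single_sum u : u = \sum_k single k (u k).
Proof.
apply/funext => i; rewrite fct_sumE (bigD1 i) //= {1}/single eqxx big1 ?addr0 //.
by move=> k ki; rewrite /single eq_sym (negbTE ki).
Qed.

Lemma single_lin a k x y : single k (a *: x + y) = a *: single k x + single k y.
Proof.
apply/funext => i; rewrite /single !fctE /=.
by case: ifP => // _; rewrite scaler0 addr0.
Qed.

Variable h : (I -> L) -> K.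
Hypotheses (hP : lin_on pdom h) (hp : forall u, pdom u -> nrm (h u) <= pnorm u).

(** Set to 0 off [D], as membership in [sdual] requires. *)
Definition component (k : I) (x : L) : K := if `[< D x >] then h (single k x) else 0.

Lemma componentE k x : D x -> component k x = h (single k x).
Proof. by move=> Dx; rewrite /component asboolT. Qed.

Lemma component_sdual k : sdual D q (component k).
Proof.
split=> [a x y Dx Dy||x nx]; last by rewrite /component asboolF.
  rewrite !componentE //; last exact: DP.2.
  by rewrite single_lin hP //; exact: single_pdom.
exists 1 => x Dx; rewrite mul1r componentE //.
by apply: le_trans (hp (single_pdom _ Dx)) (pnorm_single _ Dx).
Qed.

Lemma component_sum u : pdom u -> h u = \sum_k component k (u k).
Proof.
move=> Du; rewrite {1}(single_sum u) (lin_on_sum _ pdom_lsub hP).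
  by apply: eq_bigr => k _; rewrite componentE.
by move=> k _; exact: single_pdom.
Qed.

(** The norm dual to a maximum is a sum: [h] is tested at the single point [u] whose entries almost
    norm the components, rotated so that all contributions are nonnegative. *)
Lemma sum_dualnorm_component : \sum_k dualnorm D q (component k) <= 1.
Proof.
(* The successor keeps the denominator nonzero when [I] is empty. *)
apply/ler_addgt0Pr => e e0; pose eta := e / (#|I|.+1)%:R.
have eta0 : 0 < eta by rewrite divr_gt0 // ltr0n.
have /choice[x xP] k : exists x, [/\ D x, q x <= 1 & dualnorm D q (component k) - eta < nrm (component k x)].
  exact: (dualnorm_approx DP qP (component_sdual k)).
have /choice[t tP] k : exists t, nrm t = 1 /\ t * component k (x k) = emb b (nrm (component k (x k))).
  by have [t t1 tE] := rotate (component k (x k)); exists t.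
pose u k := t k *: x k.
have [_ _ qZ] := qP.
have Du : pdom u by move=> k; apply: lsubZ => //; case: (xP k).
have hu : h u = emb b (\sum_k nrm (component k (x k))).
  rewrite component_sum // (big_morph _ (@embD R b) (emb0 : _ = _)).
  apply: eq_bigr => k _; have [Dx _ _] := xP k; have [_ <-] := tP k.
  by have [kP _ _] := component_sdual k; rewrite (lin_onZ _ DP kP).
have : \sum_k nrm (component k (x k)) <= 1.
  rewrite -[leLHS](@nrm_emb R b); last by apply: sumr_ge0 => k _; exact: nrm_ge0.
  rewrite -hu; apply: le_trans (hp Du) _; apply: pnorm_le => // k.
  have [Dx qx _] := xP k; apply: le_trans (qZ _ _ Dx) _.
  by have [-> _] := tP k; rewrite mul1r.
move=> s1; apply: le_trans (_ : \sum_k (nrm (component k (x k)) + eta) <= _).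
  by apply: ler_sum => k _; have [_ _ /ltW] := xP k; rewrite lerBlDr.
rewrite big_split /= lerD // sumr_const -[_ *+ _]mulr_natr /eta -mulrA ler_piMr ?(ltW e0) //.
by rewrite mulrC ler_pdivrMr ?ltr0n // mul1r ler_nat ltnW.
Qed.
End MaxNorm.

(* The failure of the conclusion is a distance estimate in the product [I -> L];
   a Hahn-Banach functional [h] witnessing it splits into components [h_k], and
   the kernel lemma makes [z j] evaluate [\sum_k a k j h_k] as the point [y0 j] does. *)
Lemma simultaneous_Helly (R : realType) (b : bool) (L : lmodType (bscalar R b))
    (D : set L) (q : L -> R) (I : finType) (n m : nat)
    (a : I -> 'I_n -> bscalar R b) (z : 'I_n -> (L -> (bscalar R b)^o) -> bscalar R b)
    (V : 'I_n -> set L) (f : 'I_m -> L -> bscalar R b) (C e : R) :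
  lsub D -> snorm D q -> (forall j, lsub (V j)) -> (forall j, V j `<=` D) ->
  (forall i, sdual D q (f i)) -> (forall j, lin_on (sdual D q) (z j)) ->
  (forall j h, sdual D q h -> (forall v, V j v -> h v = 0) -> z j h = 0) ->
  0 <= C -> 0 < e ->
  (forall k h, sdual D q h -> nrm (\sum_j a k j * z j h) <= C * dualnorm D q h) ->
  exists y : 'I_n -> L, [/\ forall j, V j (y j), forall i j, f i (y j) = z j (f i) &
    forall k, q (\sum_j a k j *: y j) <= C + e].
Proof.
move=> DP qP VP VD fD zP zV C0 e0 zC.
have sP := sdual_lsub D q.
have fP i : lin_on D (f i) by case: (fD i).
have fV i j : lin_on (V j) (f i) by apply: lin_on_sub (fP i); exact: VD.
have zsum j (s : seq 'I_m) (c : 'I_m -> bscalar R b) :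
    z j (fun x => \sum_(i <- s) c i * f i x) = \sum_(i <- s) c i * z j (f i).
  have -> : (fun x => \sum_(i <- s) c i * f i x) = \sum_(i <- s) c i *: (f i : L -> (bscalar R b)^o).
    by rewrite fct_sumE.
  exact: (lin_on_comb _ _ sP (zP j)).
(* Without norm bounds the problem is interpolation in each [V j]; it is compatible because a
   combination of the [f i] vanishing on [V j] is killed by [z j]. *)
have /choice[y0 y0P] j : exists y, V j y /\ forall i, f i y = z j (f i).
  have [|c cV|y Vy yP] := @interpolation _ L (V j) m f (fun i => z j (f i)) (VP j).
  - by move=> i; exact: fV.
  - rewrite -zsum; apply: zV => //.
    rewrite (_ : (fun x => _) = \sum_i c i *: (f i : L -> (bscalar R b)^o)); last by rewrite fct_sumE.
    by apply: lsub_sum => // i _; exact: lsubZ.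
  by exists y.
apply: contrapT => ny.
(* [M] holds the effects on the combinations of all corrections [d] of [y0] that respect the
   subspaces and the prescribed values. *)
pose M : set (I -> L) := [set u | exists d : 'I_n -> L,
  [/\ forall j, V j (d j), forall i j, f i (d j) = 0 & u = fun k => \sum_j a k j *: d j]].
pose g0 : I -> L := fun k => \sum_j a k j *: y0 j.
have comD (d : 'I_n -> L) : (forall j, V j (d j)) -> pdom D (fun k => \sum_j a k j *: d j).
  by move=> dV k; apply: lsub_sum => // j _; apply: lsubZ => //; exact: (VD j).
have MP : lsub M.
  split.
    exists (fun=> 0); split=> [j|i j|]; first by case: (VP j).
      exact: lin_on0 DP (fP i).
    by apply/funext => k; rewrite big1 // => j _; rewrite scaler0.
  move=> s _ _ [d [dV fd ->]] [d' [d'V fd' ->]]; exists (fun j => s *: d j + d' j).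
  split=> [j|i j|]; first exact: (VP j).2.
    by rewrite (fV i j) // fd fd' mulr0 addr0.
  apply/funext => k; rewrite !fctE scaler_sumr -big_split /=.
  by apply: eq_bigr => j _; rewrite scalerDr !scalerA mulrC.
have [|||h [hP hp hM hg0]] :=
  @Hahn_Banach_distance R b (I -> L : lmodType (bscalar R b)) (pdom D) (pnorm q) M g0 (C + e)
    (pdom_lsub DP) (pnorm_snorm qP) MP.
- by move=> _ [d [dV _ ->]]; exact: comD.
- by apply: comD => j; case: (y0P j).
- move=> _ [d [dV fd ->]]; rewrite leNgt; apply/negP => lt; apply: ny.
  exists (fun j => y0 j + d j); split=> [j|i j|k].
  + by apply: lsubD => //; case: (y0P j).
  + have [Vy <-] := y0P j; rewrite (lin_onD (fV i j)) //.
    by rewrite fd addr0.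
  + apply: le_trans (ltW lt); apply: le_trans (le_pnorm _ _ k).
    rewrite !fctE -big_split /= le_eqVlt; apply/orP; left; apply/eqP; congr q.
    by apply: eq_bigr => j _; rewrite scalerDr.
pose hk := component D h.
have hkD k : sdual D q (hk k) := component_sdual DP qP hP hp k.
pose H j : L -> (bscalar R b)^o := \sum_k a k j *: (hk k : L -> (bscalar R b)^o).
have HD j : sdual D q (H j) by apply: lsub_sum => // k _; exact: lsubZ.
have HE j x : H j x = \sum_k a k j * hk k x by rewrite /H fct_sumE.
(* A correction concentrated at the index [j] lies in [M], where [h] vanishes. *)
have HV j v : V j v -> (forall i, f i v = 0) -> H j v = 0.
  move=> Vv fv; have Dv := VD _ _ Vv.
  pose d j' := if j' == j then v else 0.
  have dV j' : V j' (d j') by rewrite /d; case: eqP => [->//|_]; case: (VP j').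
  rewrite -(hM (fun k => \sum_j' a k j' *: d j')).
    rewrite (component_sum DP hP); last exact: comD.
    rewrite HE; apply: eq_bigr => k _; rewrite (bigD1 j) //= {1}/d eqxx big1 ?addr0.
      by have [kP _ _] := hkD k; rewrite -(lin_onZ _ DP kP).
    by move=> j' jj'; rewrite /d (negbTE jj') scaler0.
  exists d; split=> // i j'; rewrite /d; case: eqP => // _.
  exact: lin_on0 DP (fP i).
have zH j : z j (H j) = H j (y0 j).
  have [Vy fy] := y0P j; have [HjP _ _] := HD j.
  have [|||c cP] := @kernel_comb _ L (V j) m f (H j) (VP j).
  - by move=> i; exact: fV.
  - by apply: lin_on_sub HjP; exact: VD.
  - exact: HV.
  pose F : L -> (bscalar R b)^o := \sum_i c i *: (f i : L -> (bscalar R b)^o).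
  have FD : sdual D q F by apply: lsub_sum => // i _; exact: lsubZ.
  have FE x : F x = \sum_i c i * f i x by rewrite /F fct_sumE.
  have : z j (H j - F) = 0.
    apply: zV; first exact: lsubB.
    by move=> v Vv; rewrite !fctE cP // -FE subrr.
  rewrite (lin_onB sP (zP j)) // => /eqP; rewrite subr_eq0 => /eqP ->.
  rewrite cP // (lin_on_comb _ _ sP (zP j)) //.
  by apply: eq_bigr => i _; rewrite fy.
have hE : h g0 = \sum_k \sum_j a k j * z j (hk k).
  rewrite (component_sum DP hP); last by apply: comD => j; case: (y0P j).
  rewrite exchange_big /=.
  transitivity (\sum_j H j (y0 j)); last first.
    by apply: eq_bigr => j _; rewrite -zH (lin_on_comb _ _ sP (zP j)).
  under [RHS]eq_bigr do rewrite HE.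
  rewrite exchange_big; apply: eq_bigr => k _ /=.
  have [kP _ _] := hkD k; rewrite -(lin_on_comb _ _ DP kP) //.
  by move=> j _; apply: (VD j); case: (y0P j).
have : nrm (h g0) <= C.
  rewrite hE; apply: le_trans (nrm_sum _ _ _) _.
  apply: le_trans (_ : \sum_k C * dualnorm D q (hk k) <= _).
    by apply: ler_sum => k _; exact: zC.
  by rewrite -mulr_sumr ler_piMr //; exact: (sum_dualnorm_component DP qP hP hp).
by lra.
Qed.

(** * Finite nets and norming families *)

Section Nets.
Context {R : realType} {b : bool}.
Local Notation K := (bscalar R b).
Context {L : lmodType K}.
Variables (D : set L) (q : L -> R) (n : nat) (z : 'I_n -> L -> K^o).
Hypotheses (DP : lsub D) (qP : snorm D q).
Hypotheses (zD : forall j, sdual D q (z j)) (zf : ffree z).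

Definition zcomb (c : 'I_n -> K) : L -> K^o := \sum_j c j *: z j.
Local Notation N c := (dualnorm D q (zcomb c)).

Let sP : lsub (sdual D q) := sdual_lsub D q.
Let dP : snorm (sdual D q) (dualnorm D q) := dualnorm_snorm DP qP.

Lemma zcomb_sdual c : sdual D q (zcomb c).
Proof. by apply: lsub_sum => // j _; exact: lsubZ. Qed.

Lemma zcombE c x : zcomb c x = \sum_j c j * z j x.
Proof. by rewrite /zcomb fct_sumE. Qed.

Lemma zcombB c d : zcomb (fun j => c j - d j) = zcomb c - zcomb d.
Proof. by rewrite /zcomb -sumrB; apply: eq_bigr => j _; rewrite scalerBl. Qed.

Lemma zcombZ a c : zcomb (fun j => a * c j) = a *: zcomb c.
Proof. by rewrite /zcomb scaler_sumr; apply: eq_bigr => j _; rewrite scalerA. Qed.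

Lemma zcomb_ge0 c : 0 <= N c. Proof. exact: (dualnorm_ge0 DP qP (zcomb_sdual c)). Qed.

(** Freeness of [z] is the compatibility condition of [interpolation]: a relation valid on [D] holds
    everywhere, since the [z j] vanish off [D]. *)
Lemma biorthogonal : exists p : 'I_n -> L,
  (forall j, D (p j)) /\ forall i j, z i (p j) = (i == j)%:R.
Proof.
have /choice[p pP] j : exists p, D p /\ forall i, z i p = (i == j)%:R.
  have [|c cD|v Dv vP] := @interpolation _ L D n z (fun i => (i == j)%:R) DP.
  - by move=> i; case: (zD i).
  - have c0 : forall i, c i = 0.
      apply: zf; apply/funext => x; have := zcombE c x; rewrite /zcomb => ->.
      have [Dx|nx] := pselect (D x); first exact: cD.
      by apply: big1 => i _; case: (zD i) => _ _ ->; rewrite ?mulr0.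
    by apply: big1 => i _; rewrite c0 mul0r.
  - by exists v.
by exists p; split=> [j|i j]; case: (pP j).
Qed.

Lemma zcomb_biorthogonal p c j : (forall i j, z i (p j) = (i == j)%:R) ->
  zcomb c (p j) = c j.
Proof.
move=> pz; rewrite zcombE (bigD1 j) //= pz eqxx mulr1 big1 ?addr0 // => i ij.
by rewrite pz (negbTE ij) mulr0.
Qed.

Lemma zcomb_eq0 c : N c = 0 -> forall j, c j = 0.
Proof. by move=> /(dualnorm_eq0 DP qP (zcomb_sdual c)) /zf. Qed.

(** Coordinates are evaluations at biorthogonal points; the sum of their seminorms is a bound
    uniform in [j]. *)
Lemma zcomb_coef : exists B : R, forall c, N c <= 1 -> forall j, nrm (c j) <= B.
Proof.
have [p [pD pz]] := biorthogonal; have [q0 _ _] := qP.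
exists (\sum_j q (p j)) => c c1 j; rewrite -(zcomb_biorthogonal c j pz).
apply: le_trans (dualnormP DP qP (zcomb_sdual c) (pD j)) _.
apply: le_trans (_ : q (p j) <= _); first by rewrite ler_piMl // q0.
by rewrite (bigD1 j) //= lerDl sumr_ge0 // => i _; exact: q0.
Qed.

Lemma zcomb_scale c : N c != 0 -> N (fun j => emb b (N c)^-1 * c j) <= 1.
Proof.
move=> c0; rewrite zcombZ; have [_ _ dZ] := dP.
apply: le_trans (dZ _ _ (zcomb_sdual c)) _.
by rewrite nrm_emb ?invr_ge0 ?zcomb_ge0 // mulVf.
Qed.

Lemma zcomb_net (d : R) : 0 < d ->
  exists (I : finType) (a : I -> 'I_n -> K), (forall k, N (a k) <= 1) /\
    forall c, N c <= 1 -> exists k, N (fun j => c j - a k j) <= d.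
Proof.
move=> d0; have [d_ge0 _ dZ] := dP; have [B cB] := zcomb_coef.
pose s := \sum_j dualnorm D q (z j).
have s0 : 0 <= s by apply: sumr_ge0 => j _; exact: d_ge0.
(* Coefficients in the same grid cell differ by at most [2 * eta], so the combinations differ by at
   most [2 * eta * s <= d]; [s + 1] avoids dividing by zero. *)
pose eta := d / (2 * (s + 1)).
have eta0 : 0 < eta by apply: divr_gt0 => //; lra.
have [G [t tP]] := scalar_grid b B eta0.
pose near c (k : {ffun 'I_n -> 'I_G}) := forall j, nrm (c j - t (k j)) <= eta.
have N0 : N (fun=> 0) = 0.
  rewrite /zcomb big1; last by move=> j _; rewrite scale0r.
  exact: (snorm0 sP.1 dP).
(* Grid vectors may leave the unit ball, so each cell is represented by one of its points in the
   ball, or by 0 if there is none. *)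
have /choice[a aP] k : exists c, N c <= 1 /\ ((exists2 c', N c' <= 1 & near c' k) -> near c k).
  have [[c c1 ck]|nk] := pselect (exists2 c', N c' <= 1 & near c' k); first by exists c.
  by exists (fun=> 0); rewrite N0.
exists {ffun 'I_n -> 'I_G}, a; split=> [k|c c1]; first by case: (aP k).
have /choice[k kP] j := tP _ (cB _ c1 j).
exists (finfun k); have [_ ak] := aP (finfun k).
have ck : near c (finfun k) by move=> j; rewrite ffunE.
have {}ak : near (a (finfun k)) (finfun k) by apply: ak; exists c.
apply: le_trans (snorm_sum _ sP dP _) _; first by move=> j _; exact: lsubZ.
apply: le_trans (_ : \sum_j (2 * eta) * dualnorm D q (z j) <= _).
  apply: ler_sum => j _; apply: le_trans (dZ _ _ (zD j)) _.
  rewrite ler_wpM2r ?d_ge0 //.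
  have -> : c j - a (finfun k) j = (c j - t (finfun k j)) - (a (finfun k) j - t (finfun k j)).
    by rewrite opprB addrA subrK.
  by apply: le_trans (nrmD _ _) _; rewrite nrmN; have := ck j; have := ak j; lra.
rewrite -mulr_sumr -/s /eta.
have -> : 2 * (d / (2 * (s + 1))) * s = d * (s / (s + 1)) by field; lra.
by rewrite ler_piMr ?(ltW d0) // ler_pdivrMr; lra.
Qed.

Lemma zcomb_norming (d : R) : 0 < d ->
  exists (I : finType) (h : I -> L), [/\ forall k, D (h k), forall k, q (h k) <= 1 &
    forall c, exists k, N c <= (1 + d) * nrm (zcomb c (h k))].
Proof.
(* On the unit sphere [e] is lost three times: twice by passing to a net point and back, once
   because [h k] only almost norms it. The value solves [(1 + d) * (1 - 3 * e) = 1]. *)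
move=> d0; pose e := d / (3 * (1 + d)).
have e0 : 0 < e by apply: divr_gt0 => //; lra.
have eE : (1 + d) * (1 - 3 * e) = 1 by rewrite /e; field; lra.
have [I [a [a1 aN]]] := zcomb_net e0.
have /choice[h hP] k : exists x, [/\ D x, q x <= 1 & N (a k) - e < nrm (zcomb (a k) x)].
  exact: (dualnorm_approx DP qP (zcomb_sdual (a k))).
exists I, h; split=> [k|k|c]; [by case: (hP k)|by case: (hP k)|].
have unit c' : N c' = 1 -> exists k, 1 - 3 * e <= nrm (zcomb c' (h k)).
  move=> c1; have [|k kP] := aN c'; first by rewrite c1.
  exists k; have [Dh qh hk] := hP k; have [_ dD _] := dP.
  have h1 : N c' <= N (fun j => c' j - a k j) + N (a k).
    have -> : zcomb c' = zcomb (fun j => c' j - a k j) + zcomb (a k) by rewrite zcombB subrK.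
    by apply: dD; exact: zcomb_sdual.
  have h2 := dualnorm_ub DP qP (zcomb_sdual (fun j => c' j - a k j)) Dh qh.
  have h3 : nrm (zcomb (a k) (h k)) <= nrm (zcomb c' (h k)) + nrm (zcomb (fun j => c' j - a k j) (h k)).
    have -> : zcomb (a k) (h k) = zcomb c' (h k) - zcomb (fun j => c' j - a k j) (h k).
      by rewrite zcombB !fctE opprB addrC subrK.
    by apply: le_trans (nrmD _ _) _; rewrite nrmN.
  by lra.
have [c0|c0] := eqVneq (N c) 0.
  have [|k _] := aN c; first by rewrite c0.
  by exists k; rewrite c0 mulr_ge0 ?nrm_ge0 //; lra.
have Nc0 : 0 < N c by rewrite lt_def c0 zcomb_ge0.
have [|k kP] := unit (fun j => emb b (N c)^-1 * c j).
  apply/eqP; rewrite eq_le zcomb_scale //=.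
  have [_ _ dZ] := dP; have := dZ (emb b (N c)) _ (zcomb_sdual (fun j => emb b (N c)^-1 * c j)).
  rewrite {1}zcombZ scalerA -embM mulfV // emb1 scale1r nrm_emb ?(ltW Nc0) // => h1.
  by rewrite -(ler_pM2l Nc0) mulr1.
exists k; move: kP; rewrite zcombZ fctE nrmM nrm_emb ?invr_ge0 ?(ltW Nc0) // => kP.
have : (1 + d) * (1 - 3 * e) <= (1 + d) * ((N c)^-1 * nrm (zcomb c (h k))).
  by rewrite ler_wpM2l //; lra.
rewrite eE mulrCA => h1; have := ler_wpM2l (ltW Nc0) h1.
by rewrite mulr1 mulVKf.
Qed.

(** A bound on a net spreads to the ball: the supremum [sigma] of [Q] there satisfies
    [sigma <= 1 + e + e * sigma], and it is finite since coordinates are bounded. Hence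
    [sigma <= (1 + e) / (1 - e)], which is [1 + d] for the chosen [e]. The net and [e] do not depend
    on [y], which Helly's theorem can therefore supply afterwards. *)
Lemma zcomb_upper (L' : lmodType K) (D' : set L') (q' : L' -> R) (d : R) :
  lsub D' -> snorm D' q' -> 0 < d ->
  exists (I : finType) (a : I -> 'I_n -> K) (e : R), [/\ 0 < e,
    forall k, N (a k) <= 1 &
    forall y : 'I_n -> L', (forall j, D' (y j)) ->
      (forall k, q' (\sum_j a k j *: y j) <= 1 + e) ->
      forall c, q' (\sum_j c j *: y j) <= (1 + d) * N c].
Proof.
move=> DP' qP' d0; pose e := d / (2 + d).
have e0 : 0 < e by apply: divr_gt0 => //; lra.
have eE : (1 + d) * (1 - e) = 1 + e by rewrite /e; field; lra.
have e1 : e < 1 by rewrite ltr_pdivrMr; lra.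
have [I [a [a1 aN]]] := zcomb_net e0.
exists I, a, e; split=> // y yD ya; pose Q c := q' (\sum_j c j *: y j).
have [q'0 q'D q'Z] := qP'.
have yc c : D' (\sum_j c j *: y j) by apply: lsub_sum => // j _; exact: lsubZ.
have homog M : (forall c, N c <= 1 -> Q c <= M) -> forall c, Q c <= M * N c.
  move=> QM c; have [c0|c0] := eqVneq (N c) 0.
    rewrite c0 mulr0 /Q big1 ?(snorm0 DP'.1 qP') // => j _.
    by rewrite (zcomb_eq0 c0) scale0r.
  have Nc0 : 0 < N c by rewrite lt_def c0 zcomb_ge0.
  rewrite -ler_pdivrMr //; apply: le_trans (QM _ (zcomb_scale c0)).
  rewrite ler_pdivrMr // mulrC /Q.
  have -> : \sum_j c j *: y j = emb b (N c) *: \sum_j (emb b (N c)^-1 * c j) *: y j.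
    rewrite scaler_sumr; apply: eq_bigr => j _.
    by rewrite scalerA mulrA -embM mulfV // emb1 mul1r.
  by apply: le_trans (q'Z _ _ (yc _)) _; rewrite nrm_emb ?(ltW Nc0).
have [B cB] := zcomb_coef.
pose A := [set Q c | c in [set c | N c <= 1]].
have N0 : N (fun=> 0) = 0.
  rewrite /zcomb big1; last by move=> j _; rewrite scale0r.
  exact: (snorm0 sP.1 dP).
have Asup : has_sup A.
  split; first by exists (Q (fun=> 0)), (fun=> 0); rewrite //= N0.
  exists (\sum_j B * q' (y j)) => _ [c c1 <-].
  apply: le_trans (snorm_sum _ DP' qP' _) _; first by move=> j _; exact: lsubZ.
  apply: ler_sum => j _; apply: le_trans (q'Z _ _ (yD j)) _.
  by rewrite ler_wpM2r ?q'0 // cB.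
have Qsup := homog (sup A) (fun c c1 => ub_le_sup Asup.2 (ex_intro2 _ _ c c1 erefl)).
have sA : sup A <= 1 + e + e * sup A.
  apply: ge_sup; first by case: Asup.
  move=> _ [c c1 <-]; have [k kP] := aN c c1.
  have -> : Q c = q' (\sum_j a k j *: y j + \sum_j (c j - a k j) *: y j).
    by rewrite -big_split /=; congr q'; apply: eq_bigr => j _; rewrite -scalerDl addrC subrK.
  apply: le_trans (q'D _ _ (yc _) (yc _)) _; rewrite lerD //.
  apply: le_trans (Qsup _) _; rewrite mulrC ler_wpM2r //.
  by apply: le_trans (q'0 _ (yc (fun=> 0))) (ub_le_sup Asup.2 _); exists (fun=> 0); rewrite //= N0.
move=> c; apply: le_trans (Qsup c) _; rewrite ler_wpM2r ?zcomb_ge0 //.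
by rewrite -(@ler_pM2r _ (1 - e)) ?subr_gt0 // eE; lra.
Qed.
End Nets.

(** * Duals and biduals of normed spaces *)

Section Biduals.
Context {R : realType} {b : bool}.
Local Notation K := (bscalar R b).

Lemma supK_emb (T : Type) (A : set T) (F : T -> K) (M : R) : A !=set0 ->
  (forall x, A x -> 0 <= F x) -> (forall x, A x -> rep (F x) <= M) ->
  supK [set F x | x in A] = emb b (sup [set rep (F x) | x in A]).
Proof.
move=> [a Aa] F0 FM.
have [ub lub] : is_lubK [set F x | x in A] (supK [set F x | x in A]).
  apply: (@supK_lub _ _ _ M); first by exists (F a), a.
  - by move=> _ [x Ax <-]; exact: F0.
  - by move=> _ [x Ax <-]; exact: FM.
have hs : has_sup [set rep (F x) | x in A].
  split; first by exists (rep (F a)), a.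
  by exists M => _ [x Ax <-]; exact: FM.
apply/eqP; rewrite eq_le; apply/andP; split.
  apply: lub => _ [x Ax <-]; apply: le_emb_rep; first exact: F0.
  by apply: (ub_le_sup hs.2); exists x.
have s0 : 0 <= supK [set F x | x in A].
  by apply: le_trans (F0 _ Aa) (ub _ _); exists a.
rewrite -[leRHS](embK s0) ler_emb; apply: ge_sup; first by case: hs.
by move=> _ [x Ax <-]; apply: rep_le; apply: ub; exists x.
Qed.

Section OneSpace.
Variable X : normedModType K.

Definition vnorm (x : X) : R := rep `|x|.

Lemma emb_vnorm x : emb b (vnorm x) = `|x|. Proof. exact: embK. Qed.

Lemma vnorm_snorm : snorm [set: X] vnorm.
Proof.
split=> [x _|x y _ _|a x _]; first exact: rep_ge0.
  by rewrite -repD; apply: rep_le; exact: ler_normD.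
by rewrite /vnorm normrZ repM.
Qed.

(** Boundedness is stated with a constant in [K], possibly not real; its modulus is a real constant
    that works as well. *)
Lemma bounded_rep (T : Type) (P : T -> Prop) (F G : T -> K) (F' G' : T -> R) :
  (forall x, P x -> F x = emb b (F' x)) -> (forall x, P x -> G x = emb b (G' x)) ->
  (forall x, P x -> 0 <= F' x) -> (forall x, P x -> 0 <= G' x) ->
  (exists M : K, forall x, P x -> F x <= M * G x) <->
  (exists M : R, forall x, P x -> F' x <= M * G' x).
Proof.
move=> FE GE F0 G0; split=> -[M h].
  exists (nrm M) => x Px; have := h _ Px; rewrite FE // GE // => h1.
  have : 0 <= M * emb b (G' x) by apply: le_trans h1; rewrite -(@emb0 R b) ler_emb F0.
  move=> /ger0_norm h0; have := rep_le h1; rewrite repK -h0 normrM -emb_nrm.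
  by rewrite ger0_norm ?ler_emb ?G0 // -?embM ?repK // -(@emb0 R b) ler_emb G0.
by exists (emb b M) => x Px; rewrite FE // GE // -embM ler_emb h.
Qed.

(** Dual and bidual are both instances of [sdual], over [setT] and over [dual1], so nets and Helly's
    theorem apply at both levels. Writing [K^o] gives function spaces their module structure. *)
Lemma dual1E : (@dual1 K X : set (X -> K^o)) = sdual setT vnorm.
Proof.
have E (f : X -> K) : (exists M : K, forall x, setT x -> `|f x| <= M * `|x|) <->
    (exists M : R, forall x, setT x -> nrm (f x) <= M * vnorm x).
  apply: bounded_rep => x _; rewrite ?emb_nrm ?emb_vnorm ?nrm_ge0 //.
  exact: rep_ge0.
apply/seteqP; split=> f.
  move=> [fl [M fM]]; split=> [a x y _ _||x []//]; first exact: fl.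
  by apply/E; exists M => x _; exact: fM.
move=> [fl /E[M fM] _]; split=> [a x y|]; first exact: fl.
by exists M => x; exact: fM.
Qed.

Definition fnorm : (X -> K^o) -> R := dualnorm setT vnorm.

Lemma dual1_lsub : lsub (@dual1 K X : set (X -> K^o)).
Proof. by rewrite dual1E; exact: sdual_lsub. Qed.

Lemma fnorm_snorm : snorm (@dual1 K X : set (X -> K^o)) fnorm.
Proof. by rewrite dual1E; apply: dualnorm_snorm; [exact: lsubT|exact: vnorm_snorm]. Qed.

Lemma fnorm_ge0 f : dual1 f -> 0 <= fnorm f.
Proof. by have [+ _ _] := fnorm_snorm; apply. Qed.

Lemma fnormP f x : dual1 f -> nrm (f x) <= fnorm f * vnorm x.
Proof.
move=> fD; apply: (dualnormP lsubT vnorm_snorm) => //.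
by rewrite -dual1E.
Qed.

Lemma fnorm_le f M : dual1 f -> (forall x, vnorm x <= 1 -> nrm (f x) <= M) -> fnorm f <= M.
Proof.
move=> fD h; apply: (dualnorm_le lsubT vnorm_snorm); first by rewrite -dual1E.
by move=> x _; exact: h.
Qed.

Lemma vnorm_le1 x : (`|x| <= 1) = (vnorm x <= 1).
Proof. by rewrite -emb_vnorm -(@emb1 R b) ler_emb. Qed.

Lemma n1E f : dual1 f -> n1 f = emb b (fnorm f).
Proof.
move=> fD; rewrite /n1 (@supK_emb _ _ _ (fnorm f)).
- congr (emb b (sup _)); apply/seteqP; split=> _ [x /= h <-]; exists x => //=.
  + by split=> //; rewrite -vnorm_le1.
  + by rewrite vnorm_le1; case: h.
- by exists 0; rewrite /= normr0 ler01.
- by [].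
- move=> x /=; rewrite vnorm_le1 => x1; apply: le_trans (fnormP x fD) _.
  by rewrite ler_piMr // fnorm_ge0.
Qed.

Lemma bidualE : (@bidual K X : set ((X -> K^o) -> K^o)) = sdual (@dual1 K X : set (X -> K^o)) fnorm.
Proof.
have E (phi : (X -> K) -> K) : (exists M : K, forall f, dual1 f -> `|phi f| <= M * n1 f) <->
    (exists M : R, forall f, dual1 f -> nrm (phi f) <= M * fnorm f).
  apply: bounded_rep => f fD; rewrite ?emb_nrm ?nrm_ge0 //; first exact: n1E.
  exact: fnorm_ge0.
apply/seteqP; split=> phi.
  by move=> [pl [/E pb p0]]; split=> // a f g fD gD; exact: pl.
by move=> [pl /E pb p0]; split; [move=> a f g fD gD; exact: pl|split].
Qed.

Definition bnorm : ((X -> K^o) -> K^o) -> R := dualnorm (@dual1 K X : set (X -> K^o)) fnorm.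

Lemma bidual_lsub : lsub (@bidual K X : set ((X -> K^o) -> K^o)).
Proof. by rewrite bidualE; exact: sdual_lsub. Qed.

Lemma bnorm_snorm : snorm (@bidual K X : set ((X -> K^o) -> K^o)) bnorm.
Proof. by rewrite bidualE; apply: dualnorm_snorm; [exact: dual1_lsub|exact: fnorm_snorm]. Qed.

Lemma bnorm_ge0 phi : bidual phi -> 0 <= bnorm phi.
Proof. by have [+ _ _] := bnorm_snorm; apply. Qed.

Lemma bnormP phi f : bidual phi -> dual1 f -> nrm (phi f) <= bnorm phi * fnorm f.
Proof.
move=> pD fD; apply: (dualnormP dual1_lsub fnorm_snorm) => //.
by rewrite -bidualE.
Qed.

Lemma bnorm_ub phi f : bidual phi -> dual1 f -> fnorm f <= 1 -> nrm (phi f) <= bnorm phi.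
Proof.
move=> pD fD f1; apply: le_trans (bnormP pD fD) _.
by rewrite ler_piMr // bnorm_ge0.
Qed.

Lemma fnorm_le1 f : dual1 f -> (n1 f <= 1) = (fnorm f <= 1).
Proof. by move=> fD; rewrite n1E // -(@emb1 R b) ler_emb. Qed.

Lemma n2E phi : bidual phi -> n2 phi = emb b (bnorm phi).
Proof.
move=> pD; rewrite /n2 (@supK_emb _ _ _ (bnorm phi)).
- congr (emb b (sup _)); apply/seteqP; split=> _ [f /= [fD h] <-]; exists f => //=.
  + by split=> //; rewrite -fnorm_le1.
  + by split=> //; rewrite fnorm_le1.
- exists 0; split; first exact: dual1_lsub.1.
  rewrite fnorm_le1; last exact: dual1_lsub.1.
  by rewrite (snorm0 dual1_lsub.1 fnorm_snorm).
- by [].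
- by move=> f [fD]; rewrite fnorm_le1 // => f1; exact: bnorm_ub.
Qed.

Lemma bnorm_le1 phi : bidual phi -> (n2 phi <= 1) = (bnorm phi <= 1).
Proof. by move=> pD; rewrite n2E // -(@emb1 R b) ler_emb. Qed.

Lemma bidual_lin (phi : (X -> K) -> K) : bidual phi -> lin_on (@dual1 K X : set (X -> K^o)) phi.
Proof. by move=> [pl _] a f g fD gD; exact: pl. Qed.

Lemma bidual_off (phi : (X -> K) -> K) f : bidual phi -> ~ dual1 f -> phi f = 0.
Proof. by move=> [_ [_ p0]]; exact: p0. Qed.

Lemma dual1_lin (f : X -> K) : dual1 f -> lin_on [set: X] f.
Proof. by move=> [fl _] a x y _ _; exact: fl. Qed.

Lemma canJE (x : X) f : dual1 f -> canJ x f = f x.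
Proof. by move=> fD; rewrite /canJ asboolT. Qed.

Lemma canJ_off (x : X) f : ~ dual1 f -> canJ x f = 0.
Proof. by move=> fD; rewrite /canJ asboolF. Qed.

Lemma canJ_range_lsub : lsub ([set phi | exists x : X, phi = canJ x] : set ((X -> K^o) -> K^o)).
Proof.
split.
  exists 0; apply/funext => f; have [fD|nf] := pselect (dual1 f); last by rewrite canJ_off.
  by rewrite canJE // (lin_on0 lsubT (dual1_lin fD)).
move=> a _ _ [x ->] [y ->]; exists (a *: x + y); apply/funext => f.
have [fD|nf] := pselect (dual1 f); last by rewrite !fctE !canJ_off // scaler0 addr0.
by rewrite !fctE !canJE // (dual1_lin fD).
Qed.

Lemma annih2_lsub (V : set X) : lsub (annih2 V : set ((X -> K^o) -> K^o)).
Proof.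
split; first by split=> //; exact: bidual_lsub.1.
move=> a phi psi [pD p0] [sD s0]; split; first exact: bidual_lsub.2.
by move=> f Vf; rewrite !fctE p0 // s0 // scaler0 addr0.
Qed.

Lemma annih_lsub (V : set X) : lsub (annih V : set (X -> K^o)).
Proof.
split; first by split=> //; exact: dual1_lsub.1.
move=> a f g [fD f0] [gD g0]; split; first exact: dual1_lsub.2.
by move=> u Vu; rewrite !fctE f0 // g0 // scaler0 addr0.
Qed.

(** A point outside the closed [V] has positive distance to it, and Hahn-Banach yields a functional
    in the annihilator of [V] that is nonzero there. *)
Lemma canJ_annih2 (V : set X) x : closed_subspace V -> annih2 V (canJ x) -> V x.
Proof.
move=> [VP Vc] [_ xV]; apply: contrapT => nVx.
have [r r0 rV] : exists2 r : R, 0 < r & forall v, V v -> r <= vnorm (x + v).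
  have : nbhs x (~` V) by apply: open_nbhs_nbhs; split=> //; exact: closed_openC.
  rewrite -nbhs_ballE => -[e /= e0 eV].
  exists (rep e); first by rewrite -(@ltr_emb R b) emb0 embK // ltW.
  move=> v Vv; rewrite leNgt; apply/negP => lt.
  apply: (eV (- v)); last by rewrite -scaleN1r -[_ *: v]addr0; apply: VP.2 => //; exact: VP.1.
  by rewrite -ball_normE /ball_ /= opprK -emb_vnorm -[e]embK ?ltW // ltr_emb.
have [//|h [hP hb hV hx]] := @Hahn_Banach_distance R b X setT vnorm V x r lsubT vnorm_snorm VP _ I rV.
have hD : dual1 h.
  rewrite -[dual1 h]/((@dual1 K X : set (X -> K^o)) h) dual1E; split=> [||y []//]; first exact: hP.
  by exists 1 => y _; rewrite mul1r; exact: hb.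
have := xV h (conj hD hV); rewrite canJE // => h0.
by move: hx; rewrite h0 nrm0 leNgt r0.
Qed.
End OneSpace.
End Biduals.

(** * Replacing coordinates of a bidual operator *)

Section LocalReflexivity.
Context {R : realType} {b : bool}.
Local Notation K := (bscalar R b).
Variables X Y : normedModType K.
Local Notation adj1 := Defs.adj1.
Implicit Types (U : set X) (V : set Y) (S : ((X -> K) -> K) -> (Y -> K) -> K).

Lemma bidual_op_bidual S phi : bidual_op S -> bidual phi -> bidual (S phi).
Proof. by move=> [SB _]; exact: SB. Qed.

Lemma bidual_op_lin S g : bidual_op S ->
  lin_on (@bidual K X : set ((X -> K^o) -> K^o)) (fun phi => S phi g).
Proof. by move=> [_ [Sl _]] a phi psi pD sD; have /= := Sl a phi psi pD sD => ->. Qed.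

Lemma bidual_op_bounded S : bidual_op S ->
  exists M : R, forall phi, bidual phi -> bnorm (S phi) <= M * bnorm phi.
Proof.
move=> SP; have [_ [_ [Sb _]]] := SP.
suff /(_ Sb) [//] : (exists M : K, forall phi, bidual phi -> n2 (S phi) <= M * n2 phi) ->
    (exists M : R, forall phi, bidual phi -> bnorm (S phi) <= M * bnorm phi).
by move=> M h; exists M.
by apply: (proj1 (bounded_rep _ _ _ _)) => phi pD;
  [apply: n2E; exact: bidual_op_bidual|exact: n2E|
   apply: bnorm_ge0; exact: bidual_op_bidual|exact: bnorm_ge0].
Qed.

Lemma opnorm2P S : bidual_op S -> exists s : R, [/\ 0 <= s, opnorm2 S = emb b s,
  forall phi, bidual phi -> bnorm (S phi) <= s * bnorm phi &
  forall e, 0 < e -> exists phi, [/\ bidual phi, bnorm phi <= 1 & s - e < bnorm (S phi)]].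
Proof.
move=> SP; have [M SM] := bidual_op_bounded SP.
have SB phi : bidual phi -> bidual (S phi) by exact: bidual_op_bidual.
pose A := [set phi : (X -> K) -> K | bidual phi /\ n2 phi <= 1].
have A0 : A 0.
  split; first exact: (bidual_lsub X).1.
  by rewrite bnorm_le1 ?(snorm0 (bidual_lsub X).1 (bnorm_snorm X)) //; exact: (bidual_lsub X).1.
have SA phi : A phi -> rep (n2 (S phi)) <= `|M|.
  move=> [pD]; rewrite bnorm_le1 // => p1; rewrite n2E ?repK; last exact: SB.
  apply: le_trans (SM _ pD) _; apply: le_trans (_ : `|M| * bnorm phi <= _).
    by rewrite ler_wpM2r ?bnorm_ge0 // ler_norm.
  by rewrite ler_piMr.
pose s := sup [set rep (n2 (S phi)) | phi in A].
have hs : has_sup [set rep (n2 (S phi)) | phi in A].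
  split; first by exists (rep (n2 (S 0))), 0.
  by exists `|M| => _ [phi Ap <-]; exact: SA.
have ub phi : bidual phi -> bnorm phi <= 1 -> bnorm (S phi) <= s.
  move=> pD p1; rewrite -(@repK R b (bnorm (S phi))) -n2E; last exact: SB.
  by apply: (ub_le_sup hs.2); exists phi => //; split; rewrite ?bnorm_le1.
have s0 : 0 <= s.
  apply: le_trans (bnorm_ge0 (SB 0 (bidual_lsub X).1)) (ub _ (bidual_lsub X).1 _).
  by rewrite (snorm0 (bidual_lsub X).1 (bnorm_snorm X)).
exists s; split=> //.
- rewrite /opnorm2 (@supK_emb _ _ _ _ _ `|M|) //; first by exists 0.
  by move=> phi [pD _]; rewrite (n2E (SB _ pD)) -(@emb0 R b) ler_emb; exact/bnorm_ge0/SB.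
- move=> phi pD; have [pn|pn] := eqVneq (bnorm phi) 0.
    by apply: le_trans (SM _ pD) _; rewrite pn !mulr0.
  have p0 : 0 < bnorm phi by rewrite lt_def pn bnorm_ge0.
  pose psi : (X -> K^o) -> K^o := emb b (bnorm phi)^-1 *: (phi : (X -> K^o) -> K^o).
  have psiD : bidual psi by exact: (lsubZ _ (bidual_lsub X)).
  have psi1 : bnorm psi <= 1.
    have [_ _ bZ] := bnorm_snorm X; apply: le_trans (bZ _ _ pD) _.
    by rewrite nrm_emb ?invr_ge0 ?(ltW p0) // mulVf.
  have -> : S phi = emb b (bnorm phi) *: (S psi : (Y -> K^o) -> K^o).
    apply/funext => g; rewrite fctE.
    rewrite (lin_onZ _ (bidual_lsub X) (bidual_op_lin g SP)) //.
    by rewrite scalerA -embM mulfV // emb1 scale1r.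
  have [_ _ bZ] := bnorm_snorm Y; apply: le_trans (bZ _ _ (SB _ psiD)) _.
  by rewrite nrm_emb ?(ltW p0) // mulrC ler_wpM2r ?(ltW p0) // ub.
- move=> e e0; have [_ [phi [pD p1] <-] lt] := sup_adherent e0 hs.
  exists phi; split=> //; first by rewrite -bnorm_le1.
  by move: lt; rewrite n2E ?repK //; exact: SB.
Qed.

(* [S phi (p j)] is the [j]-th coordinate of [S phi] in the basis [z]. *)
Lemma range_basis S V : bidual_op S ->
  exists (r : nat) (z : 'I_r -> (Y -> K^o) -> K^o) (p : 'I_r -> Y -> K),
  [/\ ffree z,
    (forall j, exists2 phi, bidual phi & z j = S phi),
    ((forall j, dual1 (p j)) /\ forall i j, z i (p j) = (i == j)%:R),
    (forall phi, bidual phi -> S phi = \sum_j S phi (p j) *: z j) &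
    forall phi, bidual phi -> forall j, S phi (p j) != 0 ->
      ((exists y, S phi = canJ y) -> exists y, z j = canJ y) /\
      (annih2 V (S phi) -> annih2 V (z j))].
Proof.
move=> SP; have [_ [_ [_ [n [w Sw]]]]] := SP.
pose W : set ((Y -> K^o) -> K^o) := [set psi | exists2 phi, bidual phi & psi = S phi].
have WP : lsub W.
  split.
    exists 0; first exact: (bidual_lsub X).1.
    apply/funext => g; rewrite -[LHS](lin_on0 (bidual_lsub X) (bidual_op_lin g SP)).
    by [].
  move=> a _ _ [phi pD ->] [psi sD ->]; exists (a *: (phi : (X -> K^o) -> K^o) + psi).
    exact: (bidual_lsub X).2.
  by apply/funext => g; rewrite (bidual_op_lin g SP).
have Ww : W `<=` fspan (w : 'I_n -> (Y -> K^o) -> K^o).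
  move=> _ [phi pD ->]; have [c ->] := Sw _ pD; exists c.
  by rewrite fct_sumE.
(* The [w i] need not lie in the range of [S]. The list [t] spans exactly the range, so the adapted
   basis consists of values of [S], as the projection case requires. *)
have [||t [tW [tu _] _ Wt]] := @lfree_extend _ _ n (w : 'I_n -> (Y -> K^o) -> K^o) W [::].
- by split.
- by [].
rewrite cats0 in tu Wt.
pose w' (i : 'I_(size t)) := nth 0 t i.
have Ww' : W `<=` fspan w'.
  move=> psi Wpsi; have [c ->] := Wt _ Wpsi (Ww _ Wpsi).
  by exists (fun i : 'I_(size t) => c (w' i)); rewrite /comb (big_nth 0) big_mkord.
have w'W : fspan w' `<=` W.
  move=> _ [c ->]; apply: lsub_sum => // i _; apply: lsubZ => //.
  by apply: tW; exact: mem_nth.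
have [r [z [zf zw wz zP zQ]]] := adapted_basis w' (canJ_range_lsub Y) (annih2_lsub V).
have zW j : W (z j) by apply: w'W.
have zB j : bidual (z j).
  by have [phi pD ->] := zW j; exact: bidual_op_bidual.
have zD j : sdual (@dual1 K Y : set (Y -> K^o)) (@fnorm R b Y) (z j) by rewrite -bidualE.
have [p [pD pz]] := biorthogonal (dual1_lsub Y) zD zf.
have SE phi : bidual phi -> S phi = \sum_j S phi (p j) *: z j.
  move=> phiD; have [c cE] : fspan z (S phi) by apply/wz/Ww'; exists phi.
  rewrite {1}cE; apply: eq_bigr => j _.
  suff -> : S phi (p j) = c j by [].
  by rewrite cE; exact: (zcomb_biorthogonal c j pz).
exists r, z, p; split=> // phi phiD j phij; split=> h.
- by have := zP (fun j => S phi (p j)); rewrite -SE // => /(_ h j phij).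
- by have := zQ (fun j => S phi (p j)); rewrite -SE // => /(_ h j phij).
Qed.

Section Coordinates.
Variables (U : set X) (V : set Y) (S : ((X -> K) -> K) -> (Y -> K) -> K).
Variables (r : nat) (z : 'I_r -> (Y -> K^o) -> K^o) (p : 'I_r -> Y -> K).
Hypotheses (VC : closed_subspace V) (SP : bidual_op S).
Hypothesis SUV : forall phi, annih2 U phi -> annih2 V (S phi).
Hypotheses (zf : ffree z) (zB : forall j, bidual (z j)).
Hypotheses (pD : forall j, dual1 (p j)) (pz : forall i j, z i (p j) = (i == j)%:R).
Hypothesis SE : forall phi, bidual phi -> S phi = \sum_j S phi (p j) *: z j.
Hypothesis zadapted : forall phi, bidual phi -> forall j, S phi (p j) != 0 ->
  ((exists y, S phi = canJ y) -> exists y, z j = canJ y) /\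
  (annih2 V (S phi) -> annih2 V (z j)).

Lemma SEg phi g : bidual phi -> S phi g = \sum_j S phi (p j) * z j g.
Proof. by move=> phiD; rewrite {1}SE // fct_sumE. Qed.

(** Helly's theorem in [X*] for the functionals [S phi (p j)] of [phi]. With coefficients
    [z j (h k)] they combine to [S phi (h k)], of norm at most [s]. If [z j] is outside [annih2 V],
    adaptedness makes the [j]-th coordinate vanish on [annih2 U], so [f j] may be sought in
    [annih U]. *)
Lemma coordinate_functionals (J I : finType) (e : J -> (X -> K) -> K)
    (h : I -> Y -> K) (s d : R) :
  (forall i, bidual (e i)) -> (forall k, dual1 (h k)) -> (forall k, fnorm (h k) <= 1) ->
  0 <= s -> (forall phi, bidual phi -> bnorm (S phi) <= s * bnorm phi) -> 0 < d ->
  exists f : 'I_r -> X -> K^o, [/\ forall j, dual1 (f j),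
    forall j, ~ annih2 V (z j) -> annih U (f j),
    forall i j, e i (f j) = S (e i) (p j) &
    forall k, fnorm (\sum_j z j (h k) *: f j) <= s + d].
Proof.
move=> eB hD h1 s0 Ss d0.
pose W j : set (X -> K^o) := if `[< annih2 V (z j) >] then @dual1 K X else annih U.
have [||||||||f [fW fe fn]] := @simultaneous_Helly R b (X -> K^o : lmodType K) (@dual1 K X) (@fnorm R b X)
   I r #|J| (fun k j => z j (h k)) (fun j phi => S phi (p j)) W
   (fun i => e (enum_val i)) s d (dual1_lsub X) (fnorm_snorm X).
- by move=> j; rewrite /W; case: ifP => _; [exact: dual1_lsub|exact: annih_lsub].
- by move=> j; rewrite /W; case: ifP => _ // f [].
- by move=> i; rewrite -bidualE; exact: eB.
- by move=> j; rewrite -bidualE; exact: bidual_op_lin.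
- move=> j phi; rewrite -bidualE /W => phiD phi0; move: phi0; case: asboolP => [_ phi0|zV phi0].
    have -> : phi = 0.
      apply/funext => f; have [fD|nf] := pselect (dual1 f); first exact: phi0.
      exact: bidual_off.
    exact: (lin_on0 (bidual_lsub X) (bidual_op_lin (p j) SP)).
  apply/eqP; apply: contra_notT zV => phij.
  have [_] := zadapted phiD phij; apply; apply: SUV; split=> [//|f Uf].
  exact: phi0.
- exact: s0.
- exact: d0.
- move=> k phi; rewrite -bidualE => phiD.
  under eq_bigr do rewrite mulrC.
  rewrite -SEg //; apply: le_trans (_ : bnorm (S phi) <= _); last exact: Ss.
  by apply: bnorm_ub => //; exact: bidual_op_bidual.
exists f; split=> // [j|j zV|i j].
- by have := fW j; rewrite /W; case: ifP => _ // [].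
- by have := fW j; rewrite /W asboolF.
- by have := fe (enum_rank i) j; rewrite enum_rankK.
Qed.

Lemma coordinate_points (J : finType) (g : J -> Y -> K) (d : R) :
  (forall i, dual1 (g i)) -> 0 < d ->
  exists y : 'I_r -> Y, [/\ forall j, annih2 V (z j) -> V (y j),
    forall j, (exists x, z j = canJ x) -> canJ (y j) = z j,
    forall i j, g i (y j) = z j (g i) &
    forall c : 'I_r -> K, vnorm (\sum_j c j *: y j) <= (1 + d) * bnorm (\sum_j c j *: z j)].
Proof.
move=> gD d0.
have zD j : sdual (@dual1 K Y : set (Y -> K^o)) (@fnorm R b Y) (z j) by rewrite -bidualE.
have [I [a [e [e0 a1 aY]]]] :=
  zcomb_upper (dual1_lsub Y) (fnorm_snorm Y) zD zf lsubT (vnorm_snorm Y) d0.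
have VP : lsub V by case: VC => -[].
(* [y j] is sought on the line through [x] if [z j = canJ x], otherwise in [V] if [z j] belongs to
   [annih2 V], otherwise anywhere. When the first two cases overlap the line is contained in [V],
   because [V] is closed. *)
have /choice[W WP] j : exists W : set Y, [/\ lsub W,
    forall h, dual1 h -> (forall v, W v -> h v = 0) -> z j h = 0,
    annih2 V (z j) -> W `<=` V &
    (exists x, z j = canJ x) ->
      exists2 x, z j = canJ x & forall v, W v -> exists t : K, v = t *: x].
  have [[x zx]|nx] := pselect (exists x, z j = canJ x).
    exists [set v | exists t : K, v = t *: x]; split.
    - split; first by exists 0; rewrite scale0r.
      by move=> t _ _ [u ->] [v ->]; exists (t * u + v); rewrite scalerDl scalerA.
    - by move=> h hD h0; rewrite zx canJE //; apply: h0; exists 1; rewrite scale1r.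
    - rewrite zx => /(canJ_annih2 VC) Vx _ [t ->].
      exact: lsubZ.
    - by move=> _; exists x.
  have [zV|zV] := pselect (annih2 V (z j)).
    have [_ zV0] := zV; exists V; split=> [//|h hD h0|_ v//|/nx[]].
    exact: (zV0 h (conj hD h0)).
  exists setT; split=> [//|h hD h0|/zV[]|/nx[]].
  have -> : h = 0 by apply/funext => x; exact: h0.
  exact: (lin_on0 (dual1_lsub Y) (bidual_lin (zB j))).
(* The [p j] are tested along with the [g i]: the value [p j (y j) = 1] singles out [x] on its
   line. *)
have [||||||||y [yW yg yn]] := @simultaneous_Helly R b Y setT (@vnorm R b Y)
   I r #|{: J + 'I_r}| a z W
   (fun i => match enum_val i with inl i => g i | inr j => p j end) 1 e lsubT (vnorm_snorm Y).
- by move=> j; case: (WP j).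
- by [].
- by move=> i; rewrite -dual1E; case: (enum_val i) => j; [exact: gD|exact: pD].
- by move=> j; rewrite -dual1E; exact: bidual_lin.
- by move=> j h; rewrite -dual1E; case: (WP j) => _ + _ _; apply.
- exact: ler01.
- exact: e0.
- move=> k h; rewrite -dual1E => hD; rewrite mul1r -(zcombE z).
  apply: le_trans (dualnormP (dual1_lsub Y) (fnorm_snorm Y) (zcomb_sdual zD (a k)) hD) _.
  by rewrite ler_piMl // fnorm_ge0.
have yp i j : p i (y j) = (j == i)%:R.
  by have := yg (enum_rank (inr i)) j; rewrite enum_rankK => ->; exact: pz.
exists y; split=> [j zV|j zx|i j|].
- by have [_ _ /(_ zV) WV _] := WP j; exact: WV.
- have [_ _ _ /(_ zx)[x zjx Wx]] := WP j; have [t yE] := Wx _ (yW j).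
  have px : p j x = 1 by rewrite -(canJE x (pD j)) -zjx pz eqxx.
  have := yp j j; rewrite eqxx yE (lin_onZ _ lsubT (dual1_lin (pD j))) // px mulr1 => ->.
  by rewrite scale1r.
- by have := yg (enum_rank (inl i)) j; rewrite enum_rankK.
- exact: aY.
Qed.

(** * The finite-rank operator built from replaced coordinates *)

Section Assembly.
Variables (f : 'I_r -> X -> K^o) (y : 'I_r -> Y).
Hypotheses (fD : forall j, dual1 (f j)).
Hypotheses (fU : forall j, ~ annih2 V (z j) -> annih U (f j)).
Hypotheses (yV : forall j, annih2 V (z j) -> V (y j)).
Hypothesis (yJ : forall j, (exists x, z j = canJ x) -> canJ (y j) = z j).

Definition tensor (x : X) : Y := \sum_j f j x *: y j.

Lemma tensor_lin : is_lin tensor.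
Proof.
move=> a x x'; rewrite /tensor scaler_sumr -big_split /=; apply: eq_bigr => j _.
by rewrite (dual1_lin (fD j)) // scalerDl scalerA.
Qed.

Lemma tensor_finite_rank : finite_rank tensor.
Proof. by exists r, y => x; exists (fun j => f j x). Qed.

Lemma tensor_sub u : U u -> V (tensor u).
Proof.
move=> Uu; have VP : lsub V by case: VC => -[].
apply: lsub_sum => // j _; have [zV|zV] := pselect (annih2 V (z j)).
  by apply: lsubZ => //; exact: yV.
have [_ ->] // := fU zV; rewrite scale0r; exact: VP.1.
Qed.

Lemma adj1_tensor g : dual1 g -> adj1 tensor g = \sum_j g (y j) *: f j.
Proof.
move=> gD; apply/funext => x; rewrite /Defs.adj1 /tensor fct_sumE.
rewrite (lin_on_comb _ _ lsubT (dual1_lin gD)) //.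
by apply: eq_bigr => j _; exact: mulrC.
Qed.

Lemma adj1_tensor_dual1 g : dual1 g -> dual1 (adj1 tensor g).
Proof.
move=> gD; rewrite adj1_tensor //; apply: (lsub_sum _ (dual1_lsub X)) => j _.
exact: (lsubZ _ (dual1_lsub X)).
Qed.

Lemma bidual_adj1_tensor phi g : bidual phi -> dual1 g ->
  phi (adj1 tensor g) = \sum_j g (y j) * phi (f j).
Proof.
move=> phiD gD; rewrite adj1_tensor //.
exact: (lin_on_comb _ _ (dual1_lsub X) (bidual_lin phiD)).
Qed.

Lemma adj1_tensor_eq phi g : bidual phi -> dual1 g ->
  (forall j, phi (f j) = S phi (p j)) -> (forall j, g (y j) = z j g) ->
  phi (adj1 tensor g) = S phi g.
Proof.
move=> phiD gD phif gy; rewrite bidual_adj1_tensor // SEg //.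
by apply: eq_bigr => j _; rewrite phif gy mulrC.
Qed.

(** Holds at every functional, not just at tested ones: if [S phi] is canonical, its nonzero
    coordinates are along canonical [z j] only, and these are represented exactly by [y j]. *)
Lemma adj2_tensor_eq phi : bidual phi ->
  (forall j, phi (f j) = S phi (p j)) -> (exists x, S phi = canJ x) ->
  adj2 tensor phi = S phi.
Proof.
move=> phiD phif Sx; apply/funext => g; rewrite /adj2; case: asboolP => [gD|nD]; last first.
  by rewrite (bidual_off (bidual_op_bidual SP phiD) nD).
rewrite bidual_adj1_tensor // SEg //; apply: eq_bigr => j _; rewrite phif mulrC.
have [->|nz] := eqVneq (S phi (p j)) 0; first by rewrite !mul0r.
have [/(_ Sx) zx _] := zadapted phiD nz.
by rewrite -(yJ zx) canJE.
Qed.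

Lemma tensor_bounded (M : R) : (forall x, vnorm (tensor x) <= M * vnorm x) ->
  is_bdd tensor.
Proof.
move=> TM; exists (emb b M) => x.
by rewrite -!emb_vnorm -embM ler_emb.
Qed.

Lemma opnorm_tensor (M : R) : 0 <= M -> (forall x, vnorm (tensor x) <= M * vnorm x) ->
  exists t : R, [/\ opnorm tensor = emb b t, t <= M &
    forall x, vnorm x <= 1 -> vnorm (tensor x) <= t].
Proof.
move=> M0 TM; have T1 x : `|x| <= 1 -> rep `|tensor x| <= M.
  by rewrite vnorm_le1 => x1; apply: le_trans (TM x) _; rewrite ler_piMr.
have hs : has_sup [set rep `|tensor x| | x in [set x : X | `|x| <= 1]].
  split; first by exists (rep `|tensor 0|), 0; rewrite //= normr0 ler01.
  by exists M => _ [x x1 <-]; exact: T1.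
exists (sup [set rep `|tensor x| | x in [set x : X | `|x| <= 1]]); split.
- rewrite /opnorm (@supK_emb _ _ _ _ _ M) //.
  by exists 0; rewrite /= normr0 ler01.
- by apply: ge_sup; [case: hs|move=> _ [x x1 <-]; exact: T1].
- by move=> x x1; apply: (ub_le_sup hs.2); exists x; rewrite //= vnorm_le1.
Qed.

Lemma adj2_tensor_bidual (M : R) phi : 0 <= M ->
  (forall x, vnorm (tensor x) <= M * vnorm x) -> bidual phi -> bidual (adj2 tensor phi).
Proof.
move=> M0 TM phiD; rewrite -[bidual _]/((@bidual K Y : set ((Y -> K^o) -> K^o)) _) bidualE.
split.
- move=> a g h gD hD; rewrite /adj2 !asboolT //; last exact: (dual1_lsub Y).2.
  by have := bidual_lin phiD a (adj1_tensor_dual1 gD) (adj1_tensor_dual1 hD).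
- exists (bnorm phi * M) => g gD; rewrite /adj2 asboolT //.
  apply: le_trans (bnormP phiD (adj1_tensor_dual1 gD)) _; rewrite -mulrA ler_wpM2l ?bnorm_ge0 //.
  apply: fnorm_le; first exact: adj1_tensor_dual1.
  move=> x x1; apply: le_trans (fnormP _ gD) _; rewrite mulrC ler_wpM2r ?fnorm_ge0 //.
  by apply: le_trans (TM x) _; rewrite ler_piMr.
- by move=> g gD; rewrite /adj2 asboolF.
Qed.
End Assembly.
End Coordinates.
End LocalReflexivity.

(** * Norm estimates and conclusion *)

Section Conclusion.
Context {R : realType} {b : bool}.
Local Notation K := (bscalar R b).
Variables X Y : normedModType K.
Local Notation adj1 := Defs.adj1.

Lemma span2E n (e : 'I_n -> (X -> K) -> K) :
  span2 e = fspan (e : 'I_n -> (X -> K^o) -> K^o).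
Proof.
by apply/seteqP; split=> _ [c ->]; exists c; rewrite fct_sumE.
Qed.

Lemma span2_bidual n (e : 'I_n -> (X -> K) -> K) : (forall i, bidual (e i)) ->
  span2 e `<=` @bidual K X.
Proof.
move=> eB; rewrite span2E => _ [c ->].
by apply: (lsub_sum _ (bidual_lsub X)) => i _; exact: (lsubZ _ (bidual_lsub X)).
Qed.

(** Injectivity makes the images of a basis of the span free, so [zcomb_coef] bounds the coordinates
    of [phi] when [S phi] is in the unit ball; the supremum in [inv_norm_on] is thus finite. *)
Lemma inv_norm_onP (S : ((X -> K) -> K) -> (Y -> K) -> K) n (e : 'I_n -> (X -> K) -> K) :
  bidual_op S -> (forall i, bidual (e i)) -> {in span2 e &, injective S} ->
  exists t : R, [/\ 0 <= t, inv_norm_on (span2 e) S = emb b t &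
    forall phi, span2 e phi -> bnorm (S phi) <= 1 -> bnorm phi <= t].
Proof.
move=> SP eB Sinj; have eD := span2_bidual eB.
have SB phi : bidual phi -> bidual (S phi) by exact: bidual_op_bidual.
(* With both subspaces full this is merely a basis of the span of [e]. *)
have [r [z [zf ze ez _ _]]] := adapted_basis (e : 'I_n -> (X -> K^o) -> K^o) lsubT lsubT.
have zE j : span2 e (z j) by rewrite span2E.
have zB j : bidual (z j) by exact: eD.
have S0 : S 0 = 0.
  by apply/funext => g; exact: (lin_on0 (bidual_lsub X) (bidual_op_lin g SP)).
have eP : lsub (span2 e : set ((X -> K^o) -> K^o)) by rewrite span2E; exact: fspan_lsub.
have zc (c : 'I_r -> K) : span2 e (\sum_j c j *: z j).
  by apply: (lsub_sum _ eP) => j _; exact: (lsubZ _ eP).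
have Szc (c : 'I_r -> K) : S (\sum_j c j *: z j) = zcomb (fun j => S (z j) : (Y -> K^o) -> K^o) c.
  apply/funext => g; rewrite zcombE.
  exact: (lin_on_comb _ _ (bidual_lsub X) (bidual_op_lin g SP)).
have Szf : ffree (fun j => S (z j) : (Y -> K^o) -> K^o).
  move=> c; rewrite -/(zcomb _ c) -Szc -[RHS]S0 => /Sinj c0; apply: zf; apply: c0; apply: mem_set => //.
  exact: eP.1.
have SzD j : sdual (@dual1 K Y : set (Y -> K^o)) (@fnorm R b Y) (S (z j)).
  by rewrite -bidualE; exact: SB.
have [B cB] := zcomb_coef (dual1_lsub Y) (fnorm_snorm Y) SzD Szf.
pose M := \sum_j B * bnorm (z j).
have EM phi : span2 e phi -> bnorm (S phi) <= 1 -> bnorm phi <= M.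
  rewrite {1}span2E => /ez[c ->]; rewrite Szc => /cB {}cB.
  apply: le_trans (snorm_sum _ (bidual_lsub X) (bnorm_snorm X) _) _.
    by move=> j _; exact: (lsubZ _ (bidual_lsub X)).
  apply: ler_sum => j _; have [b0 _ bZ] := bnorm_snorm X.
  by apply: le_trans (bZ _ _ (zB j)) _; rewrite ler_wpM2r ?b0.
pose A := [set phi | span2 e phi /\ n2 (S phi) <= 1].
have AE phi : A phi <-> span2 e phi /\ bnorm (S phi) <= 1.
  by split=> -[pE h]; split=> //; move: h; rewrite (bnorm_le1 (SB _ (eD _ pE))).
have A0 : A 0.
  apply/AE; split; first exact: eP.1.
  by rewrite S0 (snorm0 (bidual_lsub Y).1 (bnorm_snorm Y)).
have hs : has_sup [set rep (n2 phi) | phi in A].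
  split; first by exists (rep (n2 (0 : (X -> K^o) -> K^o))), 0.
  exists M => _ [phi /AE[pE p1] <-]; rewrite n2E ?repK; first exact: EM.
  exact: eD.
have ub phi : span2 e phi -> bnorm (S phi) <= 1 -> bnorm phi <= sup [set rep (n2 phi) | phi in A].
  move=> pE p1; rewrite -(@repK R b (bnorm phi)) -n2E; last exact: eD.
  by apply: (ub_le_sup hs.2); exists phi => //; apply/AE.
exists (sup [set rep (n2 phi) | phi in A]); split=> //.
- have := ub _ eP.1; rewrite (snorm0 (bidual_lsub X).1 (bnorm_snorm X)); apply.
  by rewrite S0 (snorm0 (bidual_lsub Y).1 (bnorm_snorm Y)).
- rewrite /inv_norm_on (@supK_emb _ _ _ _ _ M) //; first by exists 0.
  + move=> phi [pE _]; rewrite n2E; last exact: eD.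
    by rewrite -(@emb0 R b) ler_emb; exact/bnorm_ge0/eD.
  + move=> phi /AE[pE p1]; rewrite n2E ?repK; first exact: EM.
    exact: eD.
Qed.

(** The inequalities serve, in order, the upper bound of the norm of [T], its lower bound, and the
    norm of the inverse. *)
Lemma small_parameter (s t eps : R) : 0 <= s -> 0 <= t -> 0 < eps ->
  exists d : R, [/\ 0 < d, (1 + d) * ((1 + d) * (s + d)) < s + eps,
    (1 + d) * (s - eps) < s - d & (1 + d) * t < t + eps].
Proof.
(* For [d <= 1] the first product exceeds [s] by at most [d * (4 + 3 * s)], the last exceeds [t] by
   [d * t]; the factor 2 gives strictness. *)
move=> s0 t0 e0; pose A := 2 * (4 + 3 * s + t).
have A0 : 0 < A by rewrite /A; lra.
pose d := Num.min 1 (eps / A).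
have d0 : 0 < d by rewrite /d lt_min ltr01 divr_gt0.
have d1 : d <= 1 by rewrite /d ge_min lexx.
have dA : d * A <= eps by rewrite -ler_pdivlMr // /d ge_min lexx orbT.
have ds : 0 <= d * s by rewrite mulr_ge0 // ltW.
have dt : 0 <= d * t by rewrite mulr_ge0 // ltW.
have de : 0 <= d * eps by rewrite mulr_ge0 // ltW.
have dd : d * d <= d by rewrite ler_piMr // ltW.
have dds : d * d * s <= d * s by rewrite ler_wpM2r.
have ddd : d * d * d <= d * d by rewrite ler_piMr // mulr_ge0 // ltW.
move: dA; rewrite /A => dA.
by exists d; split; nra.
Qed.

(** The extra test families are quantified late so that they may depend on what is already built: a
    projection takes [e' := z], then [g' := f]. The general case takes zeros. *)
Lemma local_reflexivity (U : set X) (V : set Y) (S : ((X -> K) -> K) -> (Y -> K) -> K)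
    (n : nat) (e : 'I_n -> (X -> K) -> K) (m : nat) (g : 'I_m -> Y -> K) (eps : K) :
  thm12_hyps U V S e g eps ->
  exists (r : nat) (z : 'I_r -> (Y -> K) -> K) (p : 'I_r -> Y -> K),
  [/\ forall j, exists2 phi, bidual phi & z j = S phi,
    forall i j, z i (p j) = (i == j)%:R &
    forall e' : 'I_r -> (X -> K) -> K, (forall i, bidual (e' i)) ->
    exists f : 'I_r -> X -> K, [/\ forall j, dual1 (f j),
      forall i j, e' i (f j) = S (e' i) (p j) &
      forall g' : 'I_r -> Y -> K, (forall i, dual1 (g' i)) ->
      exists y : 'I_r -> Y, (forall i j, g' i (y j) = z j (g' i)) /\
        thm12_concl U V S e g eps (fun x => \sum_j f j x *: y j)]].
Proof.
move=> [[UC VC] SP SUV [eB gD] eps0].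
have [s [s0 sE Ss Sapp]] := opnorm2P SP.
pose ep := rep eps; have epE : eps = emb b ep by rewrite embK // ltW.
have ep0 : 0 < ep by rewrite -(@ltr_emb R b) -epE emb0.
(* If [S] is not injective on the span the last clause is void, and 0 is a placeholder. *)
have [t [t0 tP]] : exists t : R, 0 <= t /\ ({in span2 e &, injective S} ->
    inv_norm_on (span2 e) S = emb b t /\
    forall phi, span2 e phi -> bnorm (S phi) <= 1 -> bnorm phi <= t).
  have [Sinj|nS] := pselect {in span2 e &, injective S}; last by exists 0.
  by have [t [t0 tE tP]] := inv_norm_onP SP eB Sinj; exists t.
have [d [d0 dS dS' dt]] := small_parameter s0 t0 ep0.
have [r [z [p [zf zS [pD pz] SE zad]]]] := range_basis V SP.
have SB phi : bidual phi -> bidual (S phi) by exact: bidual_op_bidual.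
have zB j : bidual (z j) by have [phi phiD ->] := zS j; exact: SB.
have zD j : sdual (@dual1 K Y : set (Y -> K^o)) (@fnorm R b Y) (z j) by rewrite -bidualE.
exists r, z, p; split=> // e' e'B.
have [H [h [hD h1 hn]]] := zcomb_norming (dual1_lsub Y) (fnorm_snorm Y) zD zf d0.
have [phi0 [phi0B phi01 Sphi0]] := Sapp _ d0.
(* [phi0] almost attains the norm of [S]; together with the norming [h k] among the [G'] it yields
   the lower bound for the norm of [T]. *)
pose E' (i : 'I_n + 'I_r + unit) := match i with
  | inl (inl i) => e i | inl (inr i) => e' i | inr _ => phi0 end.
have E'B i : bidual (E' i) by case: i => [[]|].
have [f [fD fU fE fn]] := coordinate_functionals SP SUV SE zad E'B hD h1 s0 Ss d0.
exists f; split=> [//|i j|g' g'D]; first exact: (fE (inl (inr i)) j).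
pose G' (i : 'I_m + 'I_r + H) := match i with
  | inl (inl i) => g i | inl (inr i) => g' i | inr k => h k end.
have G'D i : dual1 (G' i) by case: i => [[]|].
have [y [yV yJ yG yn]] := coordinate_points VC zf zB pD pz G'D d0.
exists y; split=> [i j|]; first exact: (yG (inl (inr i)) j).
pose T := tensor f y.
have eP : lsub (span2 e : set ((X -> K^o) -> K^o)) by rewrite span2E; exact: fspan_lsub.
have EB := span2_bidual eB.
have Sf phi : span2 e phi -> forall j, phi (f j) = S phi (p j).
  move=> phiE j; have := phiE; rewrite span2E => -[c ->].
  transitivity (\sum_i c i * e i (f j)); first by rewrite fct_sumE.
  rewrite (lin_on_comb _ _ (bidual_lsub X) (bidual_op_lin (p j) SP)) //.
  by apply: eq_bigr => i _; rewrite -(fE (inl (inl i)) j).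
have hk phi k : span2 e phi \/ phi = phi0 -> phi (adj1 T (h k)) = S phi (h k).
  move=> phiE; apply: (adj1_tensor_eq SE) => //.
  - by case: phiE => [/EB|->].
  - by move=> j; case: phiE => [/Sf|->]//; exact: (fE (inr tt) j).
  - by move=> j; exact: (yG (inr k) j).
have norming phi : bidual phi -> exists k, bnorm (S phi) <= (1 + d) * nrm (S phi (h k)).
  move=> phiD; have [k kP] := hn (fun j => S phi (p j)); exists k.
  by move: kP; rewrite /zcomb -SE.
(* One factor [1 + d] is for replacing [z] by [y], the other for testing on the [h k]; [s + d]
   bounds the combinations of the [f j]. *)
pose M := (1 + d) * ((1 + d) * (s + d)).
have M0 : 0 <= M by rewrite /M !mulr_ge0 //; lra.
have TM x : vnorm (T x) <= M * vnorm x.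
  apply: le_trans (yn _) _; rewrite -mulrA ler_wpM2l //; first by lra.
  have [k kP] := hn (fun j => f j x); apply: le_trans kP _.
  rewrite -mulrA ler_wpM2l //; first by lra.
  have vx : 0 <= vnorm x by have [+ _ _] := vnorm_snorm X; apply.
  apply: le_trans (_ : fnorm (\sum_j z j (h k) *: f j) * vnorm x <= _); last by rewrite ler_wpM2r.
  have -> : zcomb z (fun j => f j x) (h k) = (\sum_j z j (h k) *: f j) x.
    by rewrite zcombE fct_sumE; apply: eq_bigr => j _; exact: mulrC.
  apply: fnormP; apply: (lsub_sum _ (dual1_lsub X)) => j _.
  exact: (lsubZ _ (dual1_lsub X)).
have [tau [tauE tauM tauT]] := opnorm_tensor M0 TM.
have TB phi : bidual phi -> bidual (adj2 T phi) by exact: (adj2_tensor_bidual fD M0 TM).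
(* [adj2 T phi] and [S phi] agree at the [h k], which almost norm the range of [S]. Injectivity and
   the bound of the inverse both follow. *)
have ET phi : span2 e phi -> bnorm (S phi) <= (1 + d) * bnorm (adj2 T phi).
  move=> phiE; have phiD := EB _ phiE; have [k kP] := norming _ phiD.
  apply: le_trans kP _; rewrite ler_wpM2l //; first by lra.
  rewrite -hk; last by left.
  have -> : phi (adj1 T (h k)) = adj2 T phi (h k) by rewrite /adj2 asboolT.
  exact: bnorm_ub (TB _ phiD) (hD k) (h1 k).
split.
- split; last exact: (tensor_sub VC fU yV).
  split; first exact: tensor_lin.
  by split; [exact: (tensor_bounded TM)|exact: tensor_finite_rank].
- rewrite -[opnorm _]/(opnorm T) tauE sE epE -embB -emb_nrm ltr_emb.
  have -> : nrm (emb b (tau - s)) = `|tau - s|.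
    have [le|/ltW le] := leP 0 (tau - s); first by rewrite nrm_emb // ger0_norm.
    by rewrite -nrmN -embN nrm_emb ?oppr_ge0 // ler0_norm.
  have low : s - d < (1 + d) * tau.
    apply: lt_le_trans Sphi0 _; have [k kP] := norming _ phi0B.
    apply: le_trans kP _; rewrite ler_wpM2l //; first by lra.
    rewrite -hk; last by right.
    apply: le_trans (bnormP phi0B (adj1_tensor_dual1 y fD (hD k))) _.
    apply: le_trans (_ : fnorm (adj1 T (h k)) <= _).
      by rewrite ler_piMl // fnorm_ge0 //; exact: adj1_tensor_dual1.
    apply: fnorm_le; first exact: adj1_tensor_dual1.
    move=> x x1; apply: le_trans (fnormP _ (hD k)) _.
    apply: le_trans (_ : vnorm (T x) <= _); last exact: tauT.
    by rewrite ler_piMl //; have [+ _ _] := vnorm_snorm Y; apply.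
  rewrite ltr_norml; apply/andP; split; last by rewrite -/M in dS; lra.
  have : (1 + d) * (s - ep) < (1 + d) * tau by lra.
  by rewrite ltr_pM2l; lra.
- move=> phi ys phiE [c ysE]; have phiD := EB _ phiE.
  have ysc : ys = \sum_i c i *: (g i : Y -> K^o) by rewrite fct_sumE.
  apply: (adj1_tensor_eq SE) => //.
  + by rewrite ysc; apply: (lsub_sum _ (dual1_lsub Y)) => i _; exact: (lsubZ _ (dual1_lsub Y)).
  + exact: Sf.
  + move=> j; rewrite ysc (lin_on_comb _ _ (dual1_lsub Y) (bidual_lin (zB j))) //.
    transitivity (\sum_i c i * g i (y j)); first by rewrite fct_sumE.
    by apply: eq_bigr => i _; rewrite -(yG (inl (inl i)) j).
- move=> phi phiE Sx; apply: (adj2_tensor_eq SP SE zad fD yJ) => //; first exact: EB.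
  exact: Sf.
move=> Sinj; have [tE tS] := tP Sinj.
have adj2B phi psi : bidual phi -> bidual psi ->
    adj2 T ((phi : (X -> K^o) -> K^o) - psi) = (adj2 T phi : (Y -> K^o) -> K^o) - adj2 T psi.
  move=> phiD psiD; apply/funext => k; rewrite !fctE /adj2.
  by case: asboolP => // _; rewrite ?subrr.
split.
  move=> phi psi /set_mem phiE /set_mem psiE Teq.
  have phiD := EB _ phiE; have psiD := EB _ psiE.
  pose th : (X -> K^o) -> K^o := (phi : (X -> K^o) -> K^o) - psi.
  have thE : span2 e th by exact: (lsubB eP).
  have Sth : S th = 0.
    have thB := SB _ (EB _ thE).
    apply: (@dualnorm_eq0 _ _ _ (@dual1 K Y : set (Y -> K^o)) (@fnorm R b Y)).
    - exact: dual1_lsub.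
    - exact: fnorm_snorm.
    - by rewrite -bidualE.
    apply/eqP; rewrite eq_le; apply/andP; split; last exact: (bnorm_ge0 thB).
    apply: le_trans (ET _ thE) _; rewrite adj2B // Teq subrr.
    by rewrite (snorm0 (bidual_lsub Y).1 (bnorm_snorm Y)) mulr0.
  have S0 : S 0 = 0.
    by apply/funext => k; exact: (lin_on0 (bidual_lsub X) (bidual_op_lin k SP)).
  have : th = 0.
    by apply: Sinj; rewrite ?Sth ?S0 //; apply: mem_set => //; exact: eP.1.
  by move=> /eqP; rewrite subr_eq0 => /eqP.
rewrite tE epE -embD.
apply: le_lt_trans (_ : emb b ((1 + d) * t) < _); last by rewrite ltr_emb.
have Tt phi : span2 e phi -> n2 (adj2 T phi) <= 1 -> bnorm phi <= (1 + d) * t.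
  move=> phiE; have phiD := EB _ phiE; rewrite bnorm_le1; last exact: TB.
  move=> T1; pose psi : (X -> K^o) -> K^o := emb b (1 + d)^-1 *: (phi : (X -> K^o) -> K^o).
  have d1 : 0 < 1 + d by lra.
  have psiE : span2 e psi by exact: (lsubZ _ eP).
  have Spsi : bnorm (S psi) <= 1.
    have -> : S psi = emb b (1 + d)^-1 *: (S phi : (Y -> K^o) -> K^o).
      apply/funext => k; rewrite fctE.
      exact: (lin_onZ _ (bidual_lsub X) (bidual_op_lin k SP)).
    have [_ _ bZ] := bnorm_snorm Y; apply: le_trans (bZ _ _ (SB _ phiD)) _.
    rewrite nrm_emb ?invr_ge0 ?(ltW d1) // mulrC ler_pdivrMr // mul1r.
    by apply: le_trans (ET _ phiE) _; rewrite ler_piMr // ltW.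
  have -> : phi = emb b (1 + d) *: psi.
    by rewrite scalerA -embM mulfV ?gt_eqF // emb1 scale1r.
  have [_ _ bZ] := bnorm_snorm X; apply: le_trans (bZ _ _ (EB _ psiE)) _.
  by rewrite nrm_emb ?(ltW d1) // ler_wpM2l ?(ltW d1) // tS.
have T0 : adj2 T 0 = 0 by apply/funext => k; rewrite /adj2; case: ifP.
have [||| _ lub] := @supK_lub R b [set n2 phi | phi in [set phi | span2 e phi /\ n2 (adj2 T phi) <= 1]]
  ((1 + d) * t).
- exists (n2 (0 : (X -> K^o) -> K^o)), 0 => //; split; first exact: eP.1.
  by rewrite T0 bnorm_le1 ?(snorm0 (bidual_lsub Y).1 (bnorm_snorm Y)) //; exact: (bidual_lsub Y).1.
- move=> _ [phi [phiE _] <-]; rewrite (n2E (EB _ phiE)) -(@emb0 R b) ler_emb.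
  exact/bnorm_ge0/EB.
- by move=> _ [phi [phiE p1] <-]; rewrite (n2E (EB _ phiE)) repK; exact: Tt.
apply: lub => _ [phi [phiE p1] <-]; rewrite (n2E (EB _ phiE)) ler_emb.
exact: Tt.
Qed.
End Conclusion.

Unset Implicit Arguments.

Theorem theorem1p2 (R : realType) (b : bool) :
  (forall (X Y : completeNormedModType (bscalar R b)) (U : set X) (V : set Y)
      (S : ((X -> bscalar R b) -> bscalar R b) -> ((Y -> bscalar R b) -> bscalar R b))
      (n : nat) (e : 'I_n -> (X -> bscalar R b) -> bscalar R b)
      (m : nat) (g : 'I_m -> Y -> bscalar R b) (eps : bscalar R b),
    thm12_hyps U V S e g eps ->
    exists T : X -> Y, thm12_concl U V S e g eps T) /\
  (forall (X : completeNormedModType (bscalar R b)) (U V : set X)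
      (S : ((X -> bscalar R b) -> bscalar R b) -> ((X -> bscalar R b) -> bscalar R b))
      (n : nat) (e : 'I_n -> (X -> bscalar R b) -> bscalar R b)
      (m : nat) (g : 'I_m -> X -> bscalar R b) (eps : bscalar R b),
    thm12_hyps U V S e g eps ->
    (forall phi, bidual phi -> S (S phi) = S phi) ->
    exists T : X -> X, thm12_concl U V S e g eps T /\
      (forall x, T (T x) = T x)).
Proof.
split=> [X Y U V S n e m g eps hyps|X U V S n e m g eps hyps S2].
  have [r [z [p [_ _ zp]]]] := local_reflexivity hyps.
  have [f [_ _ fP]] := zp (fun=> 0) (fun=> (bidual_lsub X).1).
  have [y [_ yP]] := fP (fun=> 0) (fun=> (dual1_lsub Y).1).
  by exists (fun x => \sum_j f j x *: y j).
have [r [z [p [zS pz zp]]]] := local_reflexivity hyps.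
have zB j : bidual (z j).
  by have [phi phiD ->] := zS j; case: hyps => _ SP _ _ _; exact: bidual_op_bidual.
have [f [fD zf fP]] := zp z zB.
have [y [fy yP]] := fP f fD.
exists (fun x => \sum_j f j x *: y j); split=> // x.
apply: eq_bigr => i _; congr (_ *: _).
rewrite (lin_on_comb _ _ lsubT (dual1_lin (fD i))) // (bigD1 i) //=.
(* Being a value of [S], [z j] is fixed by [S], so [z j (f i) = S (z j) (p i) = z j (p i)]. *)
have fyE j : f i (y j) = (j == i)%:R.
  rewrite fy zf; have [phi phiD zE] := zS j.
  by rewrite {1}zE S2 // -zE pz.
rewrite fyE eqxx mulr1 big1 ?addr0 // => j ji.
by rewrite fyE (negbTE ji) mulr0.
Qed.
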